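(* Let $D$ be a rectangle in $\mathbb R^2$. Let $f=f_{asyche}:D\to\mathbb R^3$ be a $C^{1M}$ regular immersion in asymptotic Chebyshev coordinates $(x,y)$, let $\theta$, the angle from $f_x$ to $f_y$, satisfy $0<\theta<\pi$, and assume that $N:=\dfrac{f_x\times f_y}{\sin\theta}$ is $C^{1M}$, that $N_{xy}=N_{yx}=\cos\theta\,N$, and that $f_x=N\times N_x$ and $f_y=-N\times N_y$. Then the metric on $D$ induced by $f_{asyche}$ is not complete.
   Context: A rectangle is a product of two open intervals (bounded or unbounded), with coordinates $(x,y)$. A $C^1$ map $g$ is $C^{1M}$ if its mixed second partials $g_{xy},g_{yx}$ exist, are continuous and are equal. A $C^1$ map is regular if it has rank $2$ everywhere. $f$ is Chebyshev if $\langle f_x,f_x\rangle=\langle f_y,f_y\rangle=1$ and asymptotic if $\langle f_x,N_x\rangle=0=\langle f_y,N_y\rangle$. The induced metric is the (continuous) Riemannian metric $f^*\langle\cdot,\cdot\rangle$ on $D$. *)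

(* Defs.v *)
From Stdlib Require Import Reals.
From Coquelicot Require Import Coquelicot.
Open Scope R_scope.

Notation R2 := (R * R)%type.
Notation R3 := (R * R * R)%type.

Definition c1 (v : R3) : R := fst (fst v).
Definition c2 (v : R3) : R := snd (fst v).
Definition c3 (v : R3) : R := snd v.

Definition dot (u v : R3) : R := c1 u * c1 v + c2 u * c2 v + c3 u * c3 v.

Definition norm3 (v : R3) : R := sqrt (dot v v).

Definition cross (u v : R3) : R3 :=
  (c2 u * c3 v - c3 u * c2 v,
   c3 u * c1 v - c1 u * c3 v,
   c1 u * c2 v - c2 u * c1 v).

(* With the restriction 0 < t < PI imposed in the theorem, this determines t. *)
Definition is_angle (u v : R3) (t : R) : Prop :=
  dot u v = norm3 u * norm3 v * cos t.

(* Maps on a domain are total functions on the plane. All domains below are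
   open, so derivatives and continuity at a point of the domain do not depend
   on the values outside it. *)

Definition rectangle (a b c d : Rbar) (p : R2) : Prop :=
  (Rbar_lt a (fst p) /\ Rbar_lt (fst p) b) /\
  (Rbar_lt c (snd p) /\ Rbar_lt (snd p) d).

(* As with [Derive], the values of [dx] and [dy] are meaningful only where
   [ex_dx] and [ex_dy] hold. *)

Definition ex_dx (g : R2 -> R3) (p : R2) : Prop :=
  ex_derive (fun t : R => g (t, snd p)) (fst p).

Definition ex_dy (g : R2 -> R3) (p : R2) : Prop :=
  ex_derive (fun t : R => g (fst p, t)) (snd p).

Definition dx (g : R2 -> R3) (p : R2) : R3 :=
  (Derive (fun t => c1 (g (t, snd p))) (fst p),
   Derive (fun t => c2 (g (t, snd p))) (fst p),
   Derive (fun t => c3 (g (t, snd p))) (fst p)).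

Definition dy (g : R2 -> R3) (p : R2) : R3 :=
  (Derive (fun t => c1 (g (fst p, t))) (snd p),
   Derive (fun t => c2 (g (fst p, t))) (snd p),
   Derive (fun t => c3 (g (fst p, t))) (snd p)).

(* g_xy = (g_x)_y and g_yx = (g_y)_x. *)
Definition dxy (g : R2 -> R3) : R2 -> R3 := dy (dx g).
Definition dyx (g : R2 -> R3) : R2 -> R3 := dx (dy g).

Definition C1 (D : R2 -> Prop) (g : R2 -> R3) : Prop :=
  forall p, D p ->
    ex_dx g p /\ ex_dy g p /\ continuous (dx g) p /\ continuous (dy g) p.

Definition C1M (D : R2 -> Prop) (g : R2 -> R3) : Prop :=
  C1 D g /\
  forall p, D p ->
    ex_dy (dx g) p /\ ex_dx (dy g) p /\
    continuous (dxy g) p /\ continuous (dyx g) p /\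
    dxy g p = dyx g p.

Definition differential (g : R2 -> R3) (p v : R2) : R3 :=
  plus (scal (fst v) (dx g p)) (scal (snd v) (dy g p)).

(* The differential has rank 2, i.e. its two columns are independent. *)
Definition regular (D : R2 -> Prop) (g : R2 -> R3) : Prop :=
  forall p, D p ->
    forall v : R2, differential g p v = zero -> v = zero.

Definition chebyshev (D : R2 -> Prop) (f : R2 -> R3) : Prop :=
  forall p, D p ->
    dot (dx f p) (dx f p) = 1 /\ dot (dy f p) (dy f p) = 1.

Definition asymptotic (D : R2 -> Prop) (f N : R2 -> R3) : Prop :=
  forall p, D p ->
    dot (dx f p) (dx N p) = 0 /\ dot (dy f p) (dy N p) = 0.

(* A metric sends a base point and two tangent vectors to a real number. *)

Definition induced_metric (f : R2 -> R3) (p v w : R2) : R :=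
  dot (differential f p v) (differential f p w).

(* [path_length D g p q l]: some piecewise C^1 path from p to q inside D has
   g-length l. Each arc has a two-sided derivative at its end points; this is
   no restriction, since a C^1 arc on [a, b] extends to a C^1 map on R whose
   values outside [a, b] are not required to lie in D. *)
Inductive path_length (D : R2 -> Prop) (g : R2 -> R2 -> R2 -> R) :
    R2 -> R2 -> R -> Prop :=
| path_arc : forall (a b : R) (c c' : R -> R2),
    a <= b ->
    (forall t, a <= t <= b ->
       D (c t) /\ is_derive c t (c' t) /\ continuous c' t) ->
    path_length D g (c a) (c b)
      (RInt (fun t => sqrt (g (c t) (c' t) (c' t))) a b)
| path_cat : forall (p q r : R2) (l1 l2 : R),
    path_length D g p q l1 ->
    path_length D g q r l2 ->
    path_length D g p r (l1 + l2).

(* On a path-connected domain the set of lengths is nonempty and bounded below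
   by 0, so the infimum is finite and [real] loses nothing. *)
Definition riem_dist (D : R2 -> Prop) (g : R2 -> R2 -> R2 -> R) (p q : R2) : R :=
  real (Glb_Rbar (path_length D g p q)).

Definition complete_metric (D : R2 -> Prop) (g : R2 -> R2 -> R2 -> R) : Prop :=
  forall u : nat -> R2,
    (forall n, D (u n)) ->
    (forall eps, 0 < eps ->
       exists n0, forall m n, (n0 <= m)%nat -> (n0 <= n)%nat ->
         riem_dist D g (u m) (u n) < eps) ->
    exists p, D p /\ is_lim_seq (fun n => riem_dist D g (u n) p) 0.

(* Main.v *)
From Stdlib Require Import Reals Lra Lia Psatz IndefiniteDescription.
From Coquelicot Require Import Coquelicot.
Require Import Defs.
Open Scope R_scope.

(** A complete metric would force the rectangle to be the whole plane, and on
the whole plane the angle [theta] cannot stay between 0 and [PI].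

From completeness to the plane. Coordinate curves have unit speed, so if the
rectangle had a finite side, a coordinate segment running into that side would
give a Cauchy sequence. Its limit [p] would have to be an inner point. But the
lengths of the paths ending at [p] and starting outside a small square around
[p] are bounded below ([path_length_from_outside]): a bump function supported
in the square, suitably scaled, grows along any path no faster than the length
of the path. This yields [complete_rectangle_is_plane].

On the plane. The immersion is seen through the triple [f_x, f_y, N]. Its
structure equations say that [f_xy] is normal to the surface, so [f_x] is
parallel along the [y]-curves and [f_y] along the [x]-curves. Going round a
coordinate rectangle, the alternating sum of [theta] over the corners is
therefore the holonomy, which by Gauss-Bonnet is the integral of [sin theta]:
this is the sine-Gordon equation in integrated form. The map is not regular
enough to differentiate [theta] itself. Instead, near each point [theta] is
written as [beta - alpha], where [alpha] and [beta] are the angles of [f_x] and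
[f_y] against a fixed vector projected to the tangent planes. The function
[alpha] has a mixed derivative taken first in [y] and then in [x], [beta] one
taken in the other order, and two mean value theorems give
[box_diff_angle_local]. A compactness and additivity argument ([box_diff_ge])
turns this infinitesimal estimate into the statement that the alternating sum
of [theta] over any rectangle is at least its area times the minimum of
[sin theta].

The contradiction. The alternating sum is always below [2 * PI]. But its
monotonicity produces a half-infinite strip on which [theta] keeps a fixed
distance from 0 and [PI], where the sum has to grow without bound
([sine_gordon_no_increase]). *)

(** * Continuity and derivatives of scalar and vector functions *)

Lemma continuous_Rplus {T : UniformSpace} (f g : T -> R) x :
  continuous f x -> continuous g x -> continuous (fun z => f z + g z) x.
Proof. intros; apply (continuous_plus f g x); assumption. Qed.

Lemma continuous_Rminus {T : UniformSpace} (f g : T -> R) x :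
  continuous f x -> continuous g x -> continuous (fun z => f z - g z) x.
Proof. intros; apply (continuous_minus f g x); assumption. Qed.

Lemma continuous_Ropp {T : UniformSpace} (f : T -> R) x :
  continuous f x -> continuous (fun z => - f z) x.
Proof. intros; apply (continuous_opp f x); assumption. Qed.

Lemma continuous_Rmult {T : UniformSpace} (f g : T -> R) x :
  continuous f x -> continuous g x -> continuous (fun z => f z * g z) x.
Proof. intros; apply (continuous_mult f g x); assumption. Qed.

Lemma continuous_Rdiv {T : UniformSpace} (f g : T -> R) x :
  continuous f x -> continuous g x -> g x <> 0 ->
  continuous (fun z => f z / g z) x.
Proof.
  intros Hf Hg H0. apply continuous_Rmult; [exact Hf|].
  apply (continuous_comp g Rinv); [exact Hg|].
  apply (continuous_Rinv (g x)), H0.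
Qed.

Lemma continuous_of_continuity_pt {T : UniformSpace} (f : T -> R) (g : R -> R) x :
  continuous f x -> continuity_pt g (f x) -> continuous (fun z => g (f z)) x.
Proof.
  intros Hf Hg. apply (continuous_comp f g); [exact Hf|].
  apply continuity_pt_filterlim, Hg.
Qed.

Lemma continuous_pow2 {T : UniformSpace} (f : T -> R) x :
  continuous f x -> continuous (fun z => f z ^ 2) x.
Proof.
  intros H. apply continuous_Rmult; [exact H|].
  apply continuous_Rmult; [exact H | apply continuous_const].
Qed.

(** The goal is matched on its head symbol because trying each rule in turn by
unification unfolds the operations on reals and is very slow. *)
Ltac solve_continuous :=
  repeat first
    [ assumption
    | lazymatch goal with
      | |- continuous (fun _ => ?k) _ => apply continuous_const
      | |- continuous (fun z => _ + _) _ => apply continuous_Rplus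
      | |- continuous (fun z => _ - _) _ => apply continuous_Rminus
      | |- continuous (fun z => - _) _ => apply continuous_Ropp
      | |- continuous (fun z => _ * _) _ => apply continuous_Rmult
      | |- continuous (fun z => _ / _) _ => apply continuous_Rdiv
      | |- continuous (fun z => _ ^ 2) _ => apply continuous_pow2
      end ].

Definition continuous3 {T : UniformSpace} (F : T -> R3) (x : T) : Prop :=
  continuous (fun z => c1 (F z)) x /\ continuous (fun z => c2 (F z)) x /\
  continuous (fun z => c3 (F z)) x.

Lemma continuous3_intro {T : UniformSpace} (F : T -> R3) x :
  continuous F x -> continuous3 F x.
Proof.
  intros H.
  assert (H1 : continuous (fun z => fst (F z)) x).
  { apply (continuous_comp F fst); [exact H|].
    rewrite (surjective_pairing (F x)). apply continuous_fst. }
  split; [|split].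
  - apply (continuous_comp (fun z => fst (F z)) fst); [exact H1|].
    rewrite (surjective_pairing (fst (F x))). apply continuous_fst.
  - apply (continuous_comp (fun z => fst (F z)) snd); [exact H1|].
    rewrite (surjective_pairing (fst (F x))). apply continuous_snd.
  - apply (continuous_comp F snd); [exact H|].
    rewrite (surjective_pairing (F x)). apply continuous_snd.
Qed.

Lemma continuous_dot {T : UniformSpace} (F G : T -> R3) x :
  continuous3 F x -> continuous3 G x -> continuous (fun z => dot (F z) (G z)) x.
Proof. intros (?&?&?) (?&?&?). unfold dot. solve_continuous. Qed.

Lemma continuous3_cross {T : UniformSpace} (F G : T -> R3) x :
  continuous3 F x -> continuous3 G x -> continuous3 (fun z => cross (F z) (G z)) x.
Proof.
  intros (?&?&?) (?&?&?). unfold continuous3, cross, c1, c2, c3 in *; simpl.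
  repeat split; solve_continuous.
Qed.

Lemma continuous3_const {T : UniformSpace} (e : R3) (x : T) :
  continuous3 (fun _ => e) x.
Proof. repeat split; apply continuous_const. Qed.

Definition is_derive3 (F : R -> R3) (t : R) (V : R3) : Prop :=
  is_derive (fun s => c1 (F s)) t (c1 V) /\
  is_derive (fun s => c2 (F s)) t (c2 V) /\
  is_derive (fun s => c3 (F s)) t (c3 V).

Lemma is_derive_linear {V W : NormedModule R_AbsRing} (F : R -> V) (l : V -> W)
  (t : R) (F' : V) :
  is_linear l -> is_derive F t F' -> is_derive (fun s => l (F s)) t (l F').
Proof.
  intros Hl HF.
  apply filterdiff_ext_lin with (fun y => l (scal y F')).
  - apply (filterdiff_comp' F l); [exact HF|].
    apply filterdiff_linear, Hl.
  - intros y. apply (linear_scal l Hl).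
Qed.

Lemma ex_derive_linear {V W : NormedModule R_AbsRing} (F : R -> V) (l : V -> W) (t : R) :
  is_linear l -> ex_derive F t -> ex_derive (fun s => l (F s)) t.
Proof.
  intros Hl (F' & HF). exists (l F'). apply is_derive_linear; assumption.
Qed.

Lemma ex_derive_components (F : R -> R3) t :
  ex_derive F t ->
  is_derive3 F t (Derive (fun s => c1 (F s)) t,
                  Derive (fun s => c2 (F s)) t,
                  Derive (fun s => c3 (F s)) t).
Proof.
  intros H. unfold is_derive3, c1, c2, c3; simpl.
  assert (H1 : ex_derive (fun s => fst (F s)) t)
    by (apply (ex_derive_linear F fst); [apply is_linear_fst | exact H]).
  split; [|split]; apply Derive_correct.
  - apply (ex_derive_linear (fun s => fst (F s)) fst); [apply is_linear_fst | exact H1].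
  - apply (ex_derive_linear (fun s => fst (F s)) snd); [apply is_linear_snd | exact H1].
  - apply (ex_derive_linear F snd); [apply is_linear_snd | exact H].
Qed.

Lemma is_derive3_dx g x y : ex_dx g (x, y) ->
  is_derive3 (fun t => g (t, y)) x (dx g (x, y)).
Proof. apply ex_derive_components. Qed.

Lemma is_derive3_dy g x y : ex_dy g (x, y) ->
  is_derive3 (fun t => g (x, t)) y (dy g (x, y)).
Proof. apply ex_derive_components. Qed.

Lemma is_derive3_ext F G t V : (forall s, F s = G s) ->
  is_derive3 F t V -> is_derive3 G t V.
Proof.
  intros E (H1 & H2 & H3); split; [|split].
  - refine (is_derive_ext _ _ _ _ _ H1); intros s; now rewrite E.
  - refine (is_derive_ext _ _ _ _ _ H2); intros s; now rewrite E.
  - refine (is_derive_ext _ _ _ _ _ H3); intros s; now rewrite E.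
Qed.

Lemma is_derive3_const e t : is_derive3 (fun _ => e) t zero.
Proof. split; [|split]; exact (is_derive_const _ t). Qed.

Lemma is_derive_Rmult (f g : R -> R) t a b :
  is_derive f t a -> is_derive g t b ->
  is_derive (fun s => f s * g s) t (a * g t + f t * b).
Proof.
  intros Hf Hg. apply (is_derive_mult f g t a b Hf Hg). exact Rmult_comm.
Qed.

Lemma is_derive_Rplus (f g : R -> R) t a b :
  is_derive f t a -> is_derive g t b -> is_derive (fun s => f s + g s) t (a + b).
Proof. intros Hf Hg. exact (is_derive_plus f g t a b Hf Hg). Qed.

Lemma is_derive_Rminus (f g : R -> R) t a b :
  is_derive f t a -> is_derive g t b -> is_derive (fun s => f s - g s) t (a - b).
Proof. intros Hf Hg. exact (is_derive_minus f g t a b Hf Hg). Qed.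

Lemma is_derive_dot F G t F' G' :
  is_derive3 F t F' -> is_derive3 G t G' ->
  is_derive (fun s => dot (F s) (G s)) t (dot F' (G t) + dot (F t) G').
Proof.
  intros (A1&A2&A3) (B1&B2&B3). unfold dot.
  replace (_ + _) with
   ((c1 F' * c1 (G t) + c1 (F t) * c1 G') + (c2 F' * c2 (G t) + c2 (F t) * c2 G')
     + (c3 F' * c3 (G t) + c3 (F t) * c3 G')) by ring.
  apply is_derive_Rplus; [apply is_derive_Rplus|]; apply is_derive_Rmult; assumption.
Qed.

Lemma is_derive3_cross F G t F' G' :
  is_derive3 F t F' -> is_derive3 G t G' ->
  is_derive3 (fun s => cross (F s) (G s)) t (plus (cross F' (G t)) (cross (F t) G')).
Proof.
  intros (A1&A2&A3) (B1&B2&B3).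
  assert (K : forall f1 g1 f2 g2 a1 b1 a2 b2 : _,
    is_derive f1 t a1 -> is_derive g1 t b1 -> is_derive f2 t a2 -> is_derive g2 t b2 ->
    is_derive (fun s => f1 s * g1 s - f2 s * g2 s) t
      ((a1 * g1 t - a2 * g2 t) + (f1 t * b1 - f2 t * b2))).
  { intros.
    replace (_ + _) with ((a1 * g1 t + f1 t * b1) - (a2 * g2 t + f2 t * b2)) by ring.
    apply is_derive_Rminus; apply is_derive_Rmult; assumption. }
  split; [|split].
  - exact (K _ _ _ _ _ _ _ _ A2 B3 A3 B2).
  - exact (K _ _ _ _ _ _ _ _ A3 B1 A1 B3).
  - exact (K _ _ _ _ _ _ _ _ A1 B2 A2 B1).
Qed.

Lemma continuous3_ext {T : UniformSpace} (F G : T -> R3) (x : T) :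
  (forall z, F z = G z) -> continuous3 F x -> continuous3 G x.
Proof.
  intros E (H1 & H2 & H3).
  split; [|split].
  - apply (continuous_ext (fun z => c1 (F z))); [intros; now rewrite E | exact H1].
  - apply (continuous_ext (fun z => c2 (F z))); [intros; now rewrite E | exact H2].
  - apply (continuous_ext (fun z => c3 (F z))); [intros; now rewrite E | exact H3].
Qed.

(** * Vector algebra in three dimensions *)

Ltac vec_unfold :=
  unfold dot, cross, plus, scal, zero, opp, mult, c1, c2, c3 in *; simpl in *;
  unfold prod_plus, prod_scal, prod_zero, prod_opp in *; simpl in *;
  unfold plus, scal, zero, opp, mult in *; simpl in *; unfold mult in *; simpl in *.

Lemma dot_scal_l k u v : dot (scal k u) v = k * dot u v.
Proof. vec_unfold; ring. Qed.

Lemma dot_plus_l u v w : dot (plus u v) w = dot u w + dot v w.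
Proof. vec_unfold; ring. Qed.

Lemma dot_comm u v : dot u v = dot v u.
Proof. unfold dot; ring. Qed.

Lemma dot_zero_r u : dot u zero = 0.
Proof. vec_unfold; ring. Qed.

Lemma triple_swap12 u v w : dot (cross u v) w = - dot v (cross u w).
Proof. unfold dot, cross, c1, c2, c3; simpl; ring. Qed.

Lemma dot_cross_cross u v w z :
  dot (cross u v) (cross w z) = dot u w * dot v z - dot u z * dot v w.
Proof. unfold dot, cross, c1, c2, c3; simpl; ring. Qed.

Lemma dot_cross_self u v : dot u (cross u v) = 0.
Proof. unfold dot, cross, c1, c2, c3; simpl; ring. Qed.

(** The square of a determinant is the Gram determinant of its columns. *)
Lemma triple_gram u n e :
  dot u (cross n e) ^ 2 =
  dot u u * dot n n * dot e e + 2 * (dot u n * dot n e * dot u e)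
  - dot u u * dot n e ^ 2 - dot n n * dot u e ^ 2 - dot e e * dot u n ^ 2.
Proof. unfold dot, cross, c1, c2, c3; simpl; ring. Qed.

Lemma triple_cross u v n e :
  dot u (cross (cross n v) e) = dot u v * dot n e - dot u n * dot v e.
Proof. unfold dot, cross, c1, c2, c3; simpl; ring. Qed.

Lemma R3_ext (u v : R3) : c1 u = c1 v -> c2 u = c2 v -> c3 u = c3 v -> u = v.
Proof.
  destruct u as [[u1 u2] u3], v as [[v1 v2] v3]; unfold c1, c2, c3; simpl.
  intros; subst; reflexivity.
Qed.

Lemma cross_zero_r u : cross u zero = zero.
Proof. apply R3_ext; vec_unfold; ring. Qed.

Lemma dot_rotation n u c s : dot u n = 0 -> dot u u = 1 -> dot n n = 1 ->
 dot (plus (scal c u) (scal s (cross n u))) (plus (scal c u) (scal s (cross n u))) = s * s + c * c.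
Proof.
  intros H1 H2 H3.
  rewrite dot_plus_l, !dot_scal_l, (dot_comm u), (dot_comm (cross n u)), !dot_plus_l, !dot_scal_l,
   (dot_comm u (cross _ _)), dot_cross_cross, (dot_comm n u), H1, H2, H3.
  replace (dot (cross n u) u) with 0 by (unfold dot, cross, c1, c2, c3; simpl; ring).
  ring.
Qed.

Lemma cross_cross_l u v w :
  cross (cross u v) w = plus (scal (dot u w) v) (scal (- dot v w) u).
Proof. apply R3_ext; vec_unfold; ring. Qed.

Lemma cross_anticomm u v : cross u v = opp (cross v u).
Proof. apply R3_ext; vec_unfold; ring. Qed.

(** * Mixed differences over coordinate rectangles *)

Definition box_diff (A : R2 -> R) (x1 x2 y1 y2 : R) : R :=
  A (x2, y2) - A (x1, y2) - A (x2, y1) + A (x1, y1).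

Lemma mean_value (f df : R -> R) a b : a < b ->
  (forall t, a <= t <= b -> is_derive f t (df t)) ->
  exists t, a <= t <= b /\ f b - f a = df t * (b - a).
Proof.
  intros Hab H.
  destruct (MVT_gen f a b df) as (t & Ht & E);
    rewrite ?Rmin_left, ?Rmax_right in * by lra.
  - intros x Hx; apply H; lra.
  - intros x Hx. apply continuity_pt_filterlim.
    apply (ex_derive_continuous f x). exists (df x); apply H; lra.
  - exists t; split; assumption.
Qed.

(** The mean value theorem is applied in [y] to the difference of the two
vertical sides, then in [x] to [a]. So [A] need only be differentiable in [y]
and its [y]-derivative in [x], which is all that the angle of [f_x] offers. *)
Lemma box_diff_mean_value (A F : R2 -> R) (a : R2 -> R) x1 x2 y1 y2 :
  x1 < x2 -> y1 < y2 ->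
  (forall x y, x1 <= x <= x2 -> y1 <= y <= y2 ->
     is_derive (fun t => A (x, t)) y (a (x, y)) /\
     is_derive (fun t => a (t, y)) x (F (x, y))) ->
  exists x y, x1 <= x <= x2 /\ y1 <= y <= y2 /\
    box_diff A x1 x2 y1 y2 = F (x, y) * ((x2 - x1) * (y2 - y1)).
Proof.
  intros Hx Hy H.
  destruct (mean_value (fun t => A (x2, t) - A (x1, t))
              (fun t => a (x2, t) - a (x1, t)) y1 y2 Hy) as (y & Iy & Ey).
  { intros t Ht; apply is_derive_Rminus; apply H; lra. }
  destruct (mean_value (fun t => a (t, y)) (fun t => F (t, y)) x1 x2 Hx)
    as (x & Ix & Ex).
  { intros t Ht; apply H; lra. }
  exists x, y; split; [exact Ix|]; split; [exact Iy|].
  unfold box_diff. rewrite Ex in Ey. lra.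
Qed.

Lemma box_diff_mean_value' (B F : R2 -> R) (b : R2 -> R) x1 x2 y1 y2 :
  x1 < x2 -> y1 < y2 ->
  (forall x y, x1 <= x <= x2 -> y1 <= y <= y2 ->
     is_derive (fun t => B (t, y)) x (b (x, y)) /\
     is_derive (fun t => b (x, t)) y (F (x, y))) ->
  exists x y, x1 <= x <= x2 /\ y1 <= y <= y2 /\
    box_diff B x1 x2 y1 y2 = F (x, y) * ((x2 - x1) * (y2 - y1)).
Proof.
  intros Hx Hy H.
  destruct (box_diff_mean_value (fun z => B (snd z, fst z)) (fun z => F (snd z, fst z))
     (fun z => b (snd z, fst z)) y1 y2 x1 x2 Hy Hx) as (y & x & Iy & Ix & E).
  { intros y x Iy Ix; simpl; apply H; assumption. }
  exists x, y; split; [exact Ix|]; split; [exact Iy|].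
  unfold box_diff in *; simpl in *; lra.
Qed.

Lemma continuous_box (f : R2 -> R) (p : R2) (eps : R) :
  continuous f p -> 0 < eps ->
  exists d, 0 < d /\ forall x y, Rabs (x - fst p) < d -> Rabs (y - snd p) < d ->
    Rabs (f (x, y) - f p) < eps.
Proof.
  intros H He.
  destruct (proj1 (filterlim_locally f (f p)) H (mkposreal eps He)) as (d & Hd).
  exists d; split; [apply cond_pos|]. intros x y Hx Hy.
  apply (Hd (x, y)). split; assumption.
Qed.

Lemma is_derive_atan_div (f g : R -> R) t f' g' :
  is_derive f t f' -> is_derive g t g' -> g t <> 0 ->
  is_derive (fun s => atan (f s / g s)) t
    ((f' * g t - f t * g') / (g t ^ 2 + f t ^ 2)).
Proof.
  intros Hf Hg H0.
  assert (H1 : g t ^ 2 + f t ^ 2 <> 0) by nra.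
  replace (_ / _) with (((f' * g t - f t * g') / g t ^ 2) * / (1 + (f t / g t)²)).
  - apply (is_derive_comp atan (fun s => f s / g s)).
    + apply is_derive_atan.
    + apply (is_derive_div f g t f' g' Hf Hg H0).
  - unfold Rsqr. field. split; nra.
Qed.

(** [(q', P')] is [(q, P)] rotated by [t]; since both vectors lie in the right
half plane their arguments are arctangents, and no multiple of [2 * PI] can
enter. *)
Lemma atan_sub_eq (t q P q' P' : R) :
  0 < t < PI -> 0 < q -> 0 < q' ->
  q' = cos t * q - sin t * P -> P' = cos t * P + sin t * q ->
  t = atan (P' / q') - atan (P / q).
Proof.
  intros Ht Hq Hq' E E'.
  assert (Hs : 0 < sin t) by (apply sin_gt_0; lra).
  pose proof (sin2_cos2 t) as Hsc. unfold Rsqr in Hsc.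
  set (w := sqrt (q ^ 2 + P ^ 2)).
  assert (Hw : 0 < w) by (apply sqrt_lt_R0; nra).
  assert (Hw2 : w * w = q ^ 2 + P ^ 2) by (apply sqrt_sqrt; nra).
  assert (HW : q' ^ 2 + P' ^ 2 = q ^ 2 + P ^ 2).
  { rewrite E, E'.
    replace (_ + _) with ((sin t * sin t + cos t * cos t) * (q ^ 2 + P ^ 2)) by ring.
    rewrite Hsc; ring. }
  assert (K : forall a b, 0 < a -> a ^ 2 + b ^ 2 = q ^ 2 + P ^ 2 ->
            sqrt (1 + (b / a)²) = w / a).
  { intros a b Ha Hab.
    replace (1 + (b / a)²) with (w / a * (w / a)).
    - apply sqrt_square, Rlt_le, Rdiv_lt_0_compat; assumption.
    - unfold Rsqr. replace (w / a * (w / a)) with (w * w / (a * a)) by (field; lra).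
      rewrite Hw2, <- Hab. field; lra. }
  assert (Hcos : cos (atan (P' / q') - atan (P / q)) = cos t).
  { rewrite cos_minus, !cos_atan, !sin_atan, (K q P), (K q' P') by auto.
    replace (_ + _) with ((q' * q + P' * P) / (w * w)) by (field; lra).
    rewrite Hw2, E, E'. field; nra. }
  assert (Hsin : sin (atan (P' / q') - atan (P / q)) = sin t).
  { rewrite sin_minus, !cos_atan, !sin_atan, (K q P), (K q' P') by auto.
    replace (_ - _) with ((P' * q - q' * P) / (w * w)) by (field; lra).
    rewrite Hw2, E, E'. field; nra. }
  pose proof (atan_bound (P' / q')). pose proof (atan_bound (P / q)).
  set (u := atan (P' / q') - atan (P / q)) in *.
  assert (0 < u).
  { destruct (Rlt_dec 0 u) as [|Hn]; [assumption|exfalso].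
    assert (0 <= sin (- u)) by (apply sin_ge_0; unfold u in *; lra).
    rewrite sin_neg in *; lra. }
  rewrite <- (acos_cos t), <- (acos_cos u), Hcos by (unfold u in *; lra). reflexivity.
Qed.

(** * Parallel nets and their angle *)

(** The structure equations of the net of coordinate curves. Here [U] and [V]
are the unit tangents and [N] the unit normal; [net_Uy] and [net_Vx] say that
each tangent field is parallel along the curves of the other family. The system
mentions only the derivatives that the immersion is known to have: [U] is never
differentiated in [x], nor [V] in [y]. *)
Record parallel_net (U V N : R2 -> R3) (theta : R2 -> R) : Prop := {
  net_angle : forall p, 0 < theta p < PI;
  net_theta_continuous : forall p, continuous theta p;
  net_U_continuous : forall p, continuous3 U p;
  net_V_continuous : forall p, continuous3 V p;
  net_N_continuous : forall p, continuous3 N p;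
  net_UU : forall p, dot (U p) (U p) = 1;
  net_NN : forall p, dot (N p) (N p) = 1;
  net_UN : forall p, dot (U p) (N p) = 0;
  net_V : forall p, V p =
    plus (scal (cos (theta p)) (U p)) (scal (sin (theta p)) (cross (N p) (U p)));
  net_Nx : forall x y,
    is_derive3 (fun t => N (t, y)) x (cross (U (x, y)) (N (x, y)));
  net_Ny : forall x y,
    is_derive3 (fun t => N (x, t)) y (cross (N (x, y)) (V (x, y)));
  net_Uy : forall x y,
    is_derive3 (fun t => U (x, t)) y (scal (sin (theta (x, y))) (N (x, y)));
  net_Vx : forall x y,
    is_derive3 (fun t => V (t, y)) x (scal (sin (theta (x, y))) (N (x, y)))
}.

(** For a fixed vector [e] of space the net is described by the scalars
[m = <N, e>], [q = <U, e>], [P = <U, N x e>], [q' = <V, e>], [P' = <V, N x e>]. Projecting [e] and [N x e] to the tangent plane gives an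
orthogonal frame of vectors of equal length, so [(q, P)] and [(q', P')] are
coordinates of [U] and [V] up to a common factor; the second pair is the first
one rotated by [theta]. *)
Section Net.
Context {U V N : R2 -> R3} {theta : R2 -> R} (H : parallel_net U V N theta) (e : R3).

Lemma net_UV p : dot (U p) (V p) = cos (theta p).
Proof.
  rewrite (net_V _ _ _ _ H p), dot_comm, dot_plus_l, !dot_scal_l,
    (dot_comm (cross _ _)), (net_UU _ _ _ _ H).
  replace (dot (U p) (cross (N p) (U p))) with 0
    by (unfold dot, cross, c1, c2, c3; simpl; ring).
  ring.
Qed.

Lemma net_NV p : dot (N p) (V p) = 0.
Proof.
  rewrite (net_V _ _ _ _ H p), dot_comm, dot_plus_l, !dot_scal_l, (net_UN _ _ _ _ H),
    (dot_comm (cross _ _)), dot_cross_self. ring.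
Qed.

Lemma net_VV p : dot (V p) (V p) = 1.
Proof.
  rewrite (net_V _ _ _ _ H p), dot_rotation; try apply H.
  apply sin2_cos2.
Qed.

Lemma net_rotation_q p : dot (V p) e =
  cos (theta p) * dot (U p) e - sin (theta p) * dot (U p) (cross (N p) e).
Proof.
  rewrite (net_V _ _ _ _ H p), dot_plus_l, !dot_scal_l, triple_swap12. ring.
Qed.

Lemma net_rotation_P p : dot (V p) (cross (N p) e) =
  cos (theta p) * dot (U p) (cross (N p) e) + sin (theta p) * dot (U p) e.
Proof.
  rewrite (net_V _ _ _ _ H p), dot_plus_l, !dot_scal_l, dot_cross_cross,
    (net_NN _ _ _ _ H), (net_UN _ _ _ _ H). ring.
Qed.

Lemma net_gram p : dot (U p) e ^ 2 + dot (U p) (cross (N p) e) ^ 2 =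
  dot e e - dot (N p) e ^ 2.
Proof.
  rewrite triple_gram, (net_UU _ _ _ _ H), (net_NN _ _ _ _ H), (net_UN _ _ _ _ H). ring.
Qed.

Lemma net_gram' p : dot (V p) e ^ 2 + dot (V p) (cross (N p) e) ^ 2 =
  dot e e - dot (N p) e ^ 2.
Proof.
  rewrite <- net_gram, net_rotation_q, net_rotation_P.
  pose proof (sin2_cos2 (theta p)) as E; unfold Rsqr in E.
  set (q := dot (U p) e); set (P := dot (U p) (cross (N p) e)).
  replace (_ + _) with ((sin (theta p) * sin (theta p) + cos (theta p) * cos (theta p))
    * (q ^ 2 + P ^ 2)) by ring.
  rewrite E; ring.
Qed.

Lemma is_derive_dot_const F t F' : is_derive3 F t F' ->
  is_derive (fun s => dot (F s) e) t (dot F' e).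
Proof.
  intros HF. rewrite <- (Rplus_0_r (dot F' e)), <- (dot_zero_r (F t)).
  exact (is_derive_dot F (fun _ => e) t F' zero HF (is_derive3_const e t)).
Qed.

Lemma is_derive_triple_const F G t F' G' : is_derive3 F t F' -> is_derive3 G t G' ->
  is_derive (fun s => dot (F s) (cross (G s) e)) t
    (dot F' (cross (G t) e) + dot (F t) (cross G' e)).
Proof.
  intros HF HG.
  replace (cross G' e) with (plus (cross G' e) (cross (G t) zero)).
  - exact (is_derive_dot F (fun s => cross (G s) e) t F' _ HF
      (is_derive3_cross G (fun _ => e) t G' zero HG (is_derive3_const e t))).
  - rewrite cross_zero_r. apply plus_zero_r.
Qed.

Lemma net_m_x x y : is_derive (fun t => dot (N (t, y)) e) x
  (dot (U (x, y)) (cross (N (x, y)) e)).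
Proof.
  replace (dot (U (x, y)) _) with (dot (cross (U (x, y)) (N (x, y))) e)
    by (unfold dot, cross, c1, c2, c3; simpl; ring).
  apply is_derive_dot_const, (net_Nx _ _ _ _ H).
Qed.

Lemma net_m_y x y : is_derive (fun t => dot (N (x, t)) e) y
  (- dot (V (x, y)) (cross (N (x, y)) e)).
Proof.
  rewrite <- triple_swap12. apply is_derive_dot_const, (net_Ny _ _ _ _ H).
Qed.

Lemma net_q_y x y : is_derive (fun t => dot (U (x, t)) e) y
  (sin (theta (x, y)) * dot (N (x, y)) e).
Proof.
  rewrite <- dot_scal_l. apply is_derive_dot_const, (net_Uy _ _ _ _ H).
Qed.

Lemma net_q'_x x y : is_derive (fun t => dot (V (t, y)) e) x
  (sin (theta (x, y)) * dot (N (x, y)) e).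
Proof.
  rewrite <- dot_scal_l. apply is_derive_dot_const, (net_Vx _ _ _ _ H).
Qed.

Lemma net_P_y x y : is_derive (fun t => dot (U (x, t)) (cross (N (x, t)) e)) y
  (cos (theta (x, y)) * dot (N (x, y)) e).
Proof.
  replace (cos _ * _) with
   (dot (scal (sin (theta (x, y))) (N (x, y))) (cross (N (x, y)) e) +
    dot (U (x, y)) (cross (cross (N (x, y)) (V (x, y))) e)).
  - exact (is_derive_triple_const _ _ _ _ _ (net_Uy _ _ _ _ H x y) (net_Ny _ _ _ _ H x y)).
  - rewrite dot_scal_l, dot_cross_self, triple_cross, net_UV, (net_UN _ _ _ _ H). ring.
Qed.

Lemma net_P'_x x y : is_derive (fun t => dot (V (t, y)) (cross (N (t, y)) e)) x
  (- cos (theta (x, y)) * dot (N (x, y)) e).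
Proof.
  replace (- cos _ * _) with
   (dot (scal (sin (theta (x, y))) (N (x, y))) (cross (N (x, y)) e) +
    dot (V (x, y)) (cross (cross (U (x, y)) (N (x, y))) e)).
  - exact (is_derive_triple_const _ _ _ _ _ (net_Vx _ _ _ _ H x y) (net_Nx _ _ _ _ H x y)).
  - rewrite dot_scal_l, dot_cross_self, triple_cross, (dot_comm (V _) (U _)),
      (dot_comm (V _) (N _)), net_UV, net_NV.
    ring.
Qed.
End Net.

(** The mixed derivative of the angle is [sin theta], as an infinitesimal
estimate. Let [alpha = atan (P / q)], [beta = atan (P' / q')] and
[W = <e, e> - m ^ 2]. The structure equations give [alpha_y = m q' / W] and
[beta_x = - m q / W], that is, the connection form of the projected frame in
the two coordinate directions. Their cross derivatives are [F1] and [F2], and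
[F2 - F1 = sin theta] at the centre [p], where [m] vanishes. *)
Lemma box_diff_angle_local U V N theta (H : parallel_net U V N theta) p eps :
  0 < eps ->
  exists d, 0 < d /\ forall x1 x2 y1 y2,
    fst p - d < x1 -> x1 < x2 -> x2 < fst p + d ->
    snd p - d < y1 -> y1 < y2 -> y2 < snd p + d ->
    (sin (theta p) - eps) * ((x2 - x1) * (y2 - y1)) <= box_diff theta x1 x2 y1 y2.
Proof.
  intros Heps.
  (* The bisector of U and V at p is tangent, so that m vanishes at p, and it
     makes an acute angle with both, so that q and q' are positive near p. *)
  set (e := plus (U p) (V p)).
  set (m := fun z => dot (N z) e).
  set (q := fun z => dot (U z) e). set (P := fun z => dot (U z) (cross (N z) e)).
  set (q' := fun z => dot (V z) e). set (P' := fun z => dot (V z) (cross (N z) e)).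
  set (W := fun z => dot e e - m z ^ 2).
  set (S := fun z => sin (theta z)).
  assert (Hm0 : m p = 0).
  { unfold m, e. rewrite dot_comm, dot_plus_l, (net_UN _ _ _ _ H), dot_comm, (net_NV H). ring. }
  assert (HC : -1 < cos (theta p)).
  { rewrite <- cos_PI. pose proof (net_angle _ _ _ _ H p). apply cos_decreasing_1; lra. }
  assert (Hq0 : 0 < q p).
  { unfold q, e. rewrite dot_comm, dot_plus_l, (net_UU _ _ _ _ H), dot_comm, (net_UV H). lra. }
  assert (Hq'0 : 0 < q' p).
  { unfold q', e. rewrite dot_comm, dot_plus_l, (net_UV H), (net_VV H). lra. }
  set (F1 := fun z => ((P z * q' z + S z * m z ^ 2) * W z + 2 * m z ^ 2 * q' z * P z) / W z ^ 2).
  set (F2 := fun z => ((P' z * q z - S z * m z ^ 2) * W z + 2 * m z ^ 2 * P' z * q z) / W z ^ 2).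
  assert (HW : forall z, q z ^ 2 + P z ^ 2 = W z) by exact (net_gram H e).
  assert (HW' : forall z, q' z ^ 2 + P' z ^ 2 = W z) by exact (net_gram' H e).
  assert (HWp : 0 < W p) by (rewrite <- HW; nra).
  assert (Hcq : continuous q p).
  { apply continuous_dot; [exact (net_U_continuous _ _ _ _ H p) | apply continuous3_const]. }
  assert (Hcq' : continuous q' p).
  { apply continuous_dot; [exact (net_V_continuous _ _ _ _ H p) | apply continuous3_const]. }
  assert (Hcm : continuous m p).
  { apply continuous_dot; [exact (net_N_continuous _ _ _ _ H p) | apply continuous3_const]. }
  assert (HcP : continuous P p).
  { apply continuous_dot; [exact (net_U_continuous _ _ _ _ H p) |].
    apply continuous3_cross; [exact (net_N_continuous _ _ _ _ H p) | apply continuous3_const]. }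
  assert (HcP' : continuous P' p).
  { apply continuous_dot; [exact (net_V_continuous _ _ _ _ H p) |].
    apply continuous3_cross; [exact (net_N_continuous _ _ _ _ H p) | apply continuous3_const]. }
  assert (HcS : continuous S p).
  { apply continuous_of_continuity_pt; [apply H | apply continuity_sin]. }
  assert (HcW : continuous W p) by (unfold W; solve_continuous).
  assert (HcF1 : continuous F1 p) by (unfold F1; solve_continuous; nra).
  assert (HcF2 : continuous F2 p) by (unfold F2; solve_continuous; nra).
  destruct (continuous_box q p (q p) Hcq Hq0) as (d1 & Hd1 & B1).
  destruct (continuous_box q' p (q' p) Hcq' Hq'0) as (d2 & Hd2 & B2).
  destruct (continuous_box F1 p (eps / 2) HcF1) as (d3 & Hd3 & B3); [lra|].
  destruct (continuous_box F2 p (eps / 2) HcF2) as (d4 & Hd4 & B4); [lra|].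
  set (d := Rmin (Rmin d1 d2) (Rmin d3 d4)).
  assert (Hd : d <= d1 /\ d <= d2 /\ d <= d3 /\ d <= d4).
  { unfold d, Rmin; repeat destruct Rle_dec; lra. }
  exists d. split; [unfold d, Rmin; repeat destruct Rle_dec; lra|].
  intros x1 x2 y1 y2 X1 X12 X2 Y1 Y12 Y2.
  assert (Q : forall x y, x1 <= x <= x2 -> y1 <= y <= y2 ->
    Rabs (x - fst p) < d /\ Rabs (y - snd p) < d).
  { intros; split; apply Rabs_def1; lra. }
  assert (Q1 : forall x y, x1 <= x <= x2 -> y1 <= y <= y2 ->
    0 < q (x, y) /\ 0 < q' (x, y)).
  { intros x y Ix Iy. destruct (Q x y Ix Iy) as (Jx & Jy).
    specialize (B1 x y ltac:(lra) ltac:(lra)). specialize (B2 x y ltac:(lra) ltac:(lra)).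
    apply Rabs_def2 in B1. apply Rabs_def2 in B2. lra. }
  assert (QW : forall x y, x1 <= x <= x2 -> y1 <= y <= y2 -> W (x, y) <> 0).
  { intros x y Ix Iy. rewrite <- HW. destruct (Q1 x y Ix Iy) as (K & _). nra. }
  set (alpha := fun z => atan (P z / q z)). set (beta := fun z => atan (P' z / q' z)).
  assert (Hth : forall x y, x1 <= x <= x2 -> y1 <= y <= y2 ->
    theta (x, y) = beta (x, y) - alpha (x, y)).
  { intros x y Ix Iy. destruct (Q1 x y Ix Iy). unfold alpha, beta.
    apply atan_sub_eq; auto; [apply H | apply (net_rotation_q H) | apply (net_rotation_P H)]. }
  assert (Eth : box_diff theta x1 x2 y1 y2 =
    box_diff beta x1 x2 y1 y2 - box_diff alpha x1 x2 y1 y2).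
  { unfold box_diff. rewrite !Hth by lra. ring. }
  destruct (box_diff_mean_value alpha F1 (fun z => m z * q' z / W z) x1 x2 y1 y2 X12 Y12)
    as (xa & ya & Ixa & Iya & Ea).
  { intros x y Ix Iy. destruct (Q1 x y Ix Iy) as (K1 & K2). specialize (QW x y Ix Iy).
    split.
    - replace (m (x, y) * q' (x, y) / W (x, y)) with
        ((cos (theta (x, y)) * m (x, y) * q (x, y) -
           P (x, y) * (sin (theta (x, y)) * m (x, y))) / (q (x, y) ^ 2 + P (x, y) ^ 2)).
      + apply is_derive_atan_div;
          [exact (net_P_y H e x y) | exact (net_q_y H e x y) | exact (Rgt_not_eq _ _ K1)].
      + rewrite HW. unfold q' at 1.
        rewrite (net_rotation_q H e). fold (q (x, y)) (P (x, y)). field; assumption.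
    - pose proof (net_m_x H e x y) as Dm. pose proof (net_q'_x H e x y) as Dq.
      fold (P (x, y)) in Dm. fold (m (x, y)) (S (x, y)) in Dq.
      change (is_derive (fun t => m (t, y)) x (P (x, y))) in Dm.
      change (is_derive (fun t => q' (t, y)) x (S (x, y) * m (x, y))) in Dq.
      replace (F1 (x, y)) with
        (((P (x, y) * q' (x, y) + m (x, y) * (S (x, y) * m (x, y))) * W (x, y)
          - (m (x, y) * q' (x, y)) * (0 - (P (x, y) * m (x, y) + m (x, y) * P (x, y))))
          / W (x, y) ^ 2) by (unfold F1; f_equal; ring).
      apply (is_derive_div (fun t => m (t, y) * q' (t, y)) (fun t => W (t, y)) x).
      + apply (is_derive_Rmult (fun t => m (t, y)) (fun t => q' (t, y))); assumption.
      + unfold W. apply (is_derive_ext (fun t => dot e e - m (t, y) * m (t, y)));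
          [intros t; simpl; ring|].
        apply is_derive_Rminus; [exact (is_derive_const _ x)|].
        apply (is_derive_Rmult (fun t => m (t, y)) (fun t => m (t, y))); assumption.
      + assumption. }
  destruct (box_diff_mean_value' beta F2 (fun z => - (m z * q z) / W z) x1 x2 y1 y2 X12 Y12)
    as (xb & yb & Ixb & Iyb & Eb).
  { intros x y Ix Iy. destruct (Q1 x y Ix Iy) as (K1 & K2). specialize (QW x y Ix Iy).
    split.
    - replace (- (m (x, y) * q (x, y)) / W (x, y)) with
        ((- cos (theta (x, y)) * m (x, y) * q' (x, y) -
           P' (x, y) * (sin (theta (x, y)) * m (x, y))) / (q' (x, y) ^ 2 + P' (x, y) ^ 2)).
      + apply is_derive_atan_div;
          [exact (net_P'_x H e x y) | exact (net_q'_x H e x y) | exact (Rgt_not_eq _ _ K2)].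
      + rewrite HW'.
        unfold q', P'.
        rewrite (net_rotation_q H e), (net_rotation_P H e). fold (q (x, y)) (P (x, y)).
        pose proof (sin2_cos2 (theta (x, y))) as Hsc; unfold Rsqr in Hsc.
        replace (- (m (x, y) * q (x, y))) with
         (- (m (x, y) * q (x, y)) * (sin (theta (x, y)) * sin (theta (x, y)) +
            cos (theta (x, y)) * cos (theta (x, y)))) by (rewrite Hsc; ring).
        field; assumption.
    - pose proof (net_m_y H e x y) as Dm. pose proof (net_q_y H e x y) as Dq.
      fold (P' (x, y)) in Dm. fold (m (x, y)) (S (x, y)) in Dq.
      change (is_derive (fun t => m (x, t)) y (- P' (x, y))) in Dm.
      change (is_derive (fun t => q (x, t)) y (S (x, y) * m (x, y))) in Dq.
      replace (F2 (x, y)) with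
        (((0 - (- P' (x, y) * q (x, y) + m (x, y) * (S (x, y) * m (x, y)))) * W (x, y)
          - (0 - m (x, y) * q (x, y)) * (0 - (- P' (x, y) * m (x, y) + m (x, y) * - P' (x, y))))
          / W (x, y) ^ 2) by (unfold F2; f_equal; ring).
      apply (is_derive_ext (fun t => (0 - m (x, t) * q (x, t)) / W (x, t)));
          [intros t; f_equal; ring|].
      apply (is_derive_div (fun t => 0 - m (x, t) * q (x, t)) (fun t => W (x, t)) y).
      + apply is_derive_Rminus; [exact (is_derive_const _ y)|].
        apply (is_derive_Rmult (fun t => m (x, t)) (fun t => q (x, t))); assumption.
      + unfold W. apply (is_derive_ext (fun t => dot e e - m (x, t) * m (x, t)));
          [intros t; simpl; ring|].
        apply is_derive_Rminus; [exact (is_derive_const _ y)|].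
        apply (is_derive_Rmult (fun t => m (x, t)) (fun t => m (x, t))); assumption.
      + assumption. }
  rewrite Eth, Ea, Eb, <- Rmult_minus_distr_r.
  apply Rmult_le_compat_r; [nra|].
  destruct (Q xa ya Ixa Iya) as (Ja & Ja'). destruct (Q xb yb Ixb Iyb) as (Jb & Jb').
  specialize (B3 xa ya ltac:(lra) ltac:(lra)). specialize (B4 xb yb ltac:(lra) ltac:(lra)).
  apply Rabs_def2 in B3. apply Rabs_def2 in B4.
  (* At p the difference is (P' q - P q') / W, the sine of the angle between
     the vectors (q, P) and (q', P'). *)
  assert (Ep : F2 p - F1 p = sin (theta p)).
  { unfold F1, F2. rewrite Hm0.
    replace (_ - _) with ((P' p * q p - P p * q' p) / W p) by (field; lra).
    unfold P', q'. rewrite (net_rotation_q H e), (net_rotation_P H e). fold (q p) (P p).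
    replace (W p) with (q p ^ 2 + P p ^ 2) by apply HW.
    field. nra. }
  lra.
Qed.

(** * The sine-Gordon inequality has no solution on the plane *)

(** An interval shorter than [(n + 1) * d] splits into one shorter than [n * d]
and one shorter than [d]. *)
Lemma interval_gluing (P : R -> R -> Prop) (lo hi d : R) :
  0 < d ->
  (forall a b, lo <= a -> a < b -> b <= hi -> b - a < d -> P a b) ->
  (forall a b c, a < b -> b < c -> P a b -> P b c -> P a c) ->
  forall a b, lo <= a -> a < b -> b <= hi -> P a b.
Proof.
  intros Hd Hs Hg.
  assert (K : forall n a b, lo <= a -> a < b -> b <= hi -> b - a < INR (S n) * d -> P a b).
  { induction n as [|n IH]; intros a b Ha Hab Hb Hn.
    - apply Hs; auto. simpl in Hn; lra.
    - rewrite S_INR in Hn. set (k := INR (S n)) in *.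
      assert (Hk : 0 < k) by (apply lt_0_INR; lia).
      assert (0 < (b - a) / (k + 1)) by (apply Rdiv_lt_0_compat; lra).
      assert (E : (b - a) / (k + 1) * (k + 1) = b - a) by (field; lra).
      set (q := (b - a) / (k + 1)) in *.
      assert (0 < q * k) by (apply Rmult_lt_0_compat; assumption).
      assert (q < d) by nra.
      apply (Hg a (b - q) b); [lra|lra| |].
      + apply IH; nra.
      + apply Hs; lra. }
  intros a b Ha Hab Hb.
  destruct (INR_archimed d (b - a) Hd) as (n & Hn).
  apply (K n); auto. rewrite S_INR. lra.
Qed.

(** Both sides are additive under cutting a rectangle. By compactness one size
[d] works for all small rectangles in place of the pointwise sizes, and gluing
in each coordinate then reaches the whole rectangle. *)
Lemma box_diff_ge (A k : R2 -> R) :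
  (forall p eps, 0 < eps -> exists d, 0 < d /\ forall x1 x2 y1 y2,
    fst p - d < x1 -> x1 < x2 -> x2 < fst p + d ->
    snd p - d < y1 -> y1 < y2 -> y2 < snd p + d ->
    (k p - eps) * ((x2 - x1) * (y2 - y1)) <= box_diff A x1 x2 y1 y2) ->
  forall s x1 x2 y1 y2, x1 < x2 -> y1 < y2 ->
  (forall x y, x1 <= x <= x2 -> y1 <= y <= y2 -> s <= k (x, y)) ->
  s * ((x2 - x1) * (y2 - y1)) <= box_diff A x1 x2 y1 y2.
Proof.
  intros Hloc s x1 x2 y1 y2 Hx Hy Hs.
  assert (Harea : 0 < (x2 - x1) * (y2 - y1)) by nra.
  cut (forall eps, 0 < eps ->
    (s - eps) * ((x2 - x1) * (y2 - y1)) <= box_diff A x1 x2 y1 y2).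
  { intros K. apply Rnot_lt_le; intros Hlt.
    set (a := (x2 - x1) * (y2 - y1)) in *. set (B := box_diff _ _ _ _ _) in *.
    assert (He : 0 < (s * a - B) / (2 * a)) by (apply Rdiv_lt_0_compat; lra).
    specialize (K _ He).
    replace ((s - (s * a - B) / (2 * a)) * a) with ((s * a + B) / 2) in K by (field; lra).
    lra. }
  intros eps Heps.
  assert (Hd : forall p, exists d : posreal, forall x1 x2 y1 y2,
    fst p - 2 * d < x1 -> x1 < x2 -> x2 < fst p + 2 * d ->
    snd p - 2 * d < y1 -> y1 < y2 -> y2 < snd p + 2 * d ->
    (k p - eps) * ((x2 - x1) * (y2 - y1)) <= box_diff A x1 x2 y1 y2).
  { intros p. destruct (Hloc p eps Heps) as (d & Hd & K).
    assert (Hd2 : 0 < d / 2) by lra.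
    (* Halving leaves room for a rectangle of side below d that only meets the
       neighbourhood of radius d of p. *)
    exists (mkposreal _ Hd2); simpl. intros; apply K; lra. }
  destruct (functional_choice _ Hd) as (delta & Hdelta).
  destruct (compactness_value_2d x1 x2 y1 y2 (fun u v => delta (u, v))) as (d & Hcov).
  apply (interval_gluing (fun a b =>
     (s - eps) * ((b - a) * (y2 - y1)) <= box_diff A a b y1 y2) x1 x2 d);
    [apply cond_pos | | intros a b c _ _ K1 K2; unfold box_diff in *; lra | lra | lra | lra].
  intros a b Ha Hab Hb Hsmall.
  apply (interval_gluing (fun u v =>
     (s - eps) * ((b - a) * (v - u)) <= box_diff A a b u v) y1 y2 d);
    [apply cond_pos | | intros u v w _ _ K1 K2; unfold box_diff in *; lra | lra | lra | lra].
  intros u v Hu Huv Hv Hsmall'.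
  apply Rnot_lt_le; intros Hlt.
  apply (Hcov a u); [lra | lra |].
  intros (p1 & p2 & I1 & I2 & A1 & A2 & Hle).
  apply Rabs_def2 in A1. apply Rabs_def2 in A2.
  assert (K := Hdelta (p1, p2) a b u v). simpl in K.
  specialize (Hs p1 p2 I1 I2).
  assert (0 < (b - a) * (v - u)) by nra.
  assert ((s - eps) * ((b - a) * (v - u)) <= (k (p1, p2) - eps) * ((b - a) * (v - u)))
    by (apply Rmult_le_compat_r; lra).
  assert (K' := K ltac:(lra) ltac:(lra) ltac:(lra) ltac:(lra) ltac:(lra) ltac:(lra)).
  lra.
Qed.

Lemma sin_ge_away_from_endpoints d t : 0 < d -> d <= t <= PI - d -> sin d <= sin t.
Proof.
  intros Hd Ht. destruct (Rle_lt_dec t (PI / 2)) as [Hle|Hlt].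
  - apply sin_incr_1; lra.
  - rewrite <- (sin_PI_x t). apply sin_incr_1; lra.
Qed.

(** An integrated form of [theta_xy >= sin theta], meaningful for merely
continuous [theta]. *)
Definition sine_gordon_inequality (theta : R2 -> R) : Prop :=
  forall s x1 x2 y1 y2, x1 < x2 -> y1 < y2 ->
  (forall x y, x1 <= x <= x2 -> y1 <= y <= y2 -> s <= sin (theta (x, y))) ->
  s * ((x2 - x1) * (y2 - y1)) <= box_diff theta x1 x2 y1 y2.

(** Since the mixed difference is nonnegative, increments of [theta] in [x] do
not decrease as [y] grows. Around a point [xi] where [theta (x, y0)] is halfway
between its values at [x1] and [x2], the angle therefore stays at least a
quarter of the increment above 0 and below [PI] for all [y >= y0]. On this strip
[sin theta] is bounded below, so the mixed difference over a tall enough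
rectangle exceeds its a priori bound [2 * PI]. *)
Lemma sine_gordon_no_increase (theta : R2 -> R) :
  (forall p, 0 < theta p < PI) -> (forall p, continuous theta p) ->
  sine_gordon_inequality theta ->
  forall x1 x2 y0, x1 < x2 -> theta (x1, y0) < theta (x2, y0) -> False.
Proof.
  intros Hr Hc Hsg x1 x2 y0 Hx Hlt.
  set (phi := fun x => theta (x, y0)).
  assert (Hphi : continuity phi).
  { intros x. apply continuity_pt_locally. intros eps.
    destruct (continuous_box theta (x, y0) eps (Hc _) (cond_pos eps)) as (d & Hd & K).
    exists (mkposreal d Hd). intros t Ht. apply K; [exact Ht|].
    simpl. rewrite Rminus_diag, Rabs_R0. exact Hd. }
  assert (Hlt' : phi x1 < phi x2) by exact Hlt.
  set (del := phi x2 - phi x1).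
  assert (Hdel : 0 < del) by (unfold del, phi; lra).
  destruct (IVT_gen phi x1 x2 (phi x1 + del / 2) Hphi) as (xi & Ixi & Exi).
  { rewrite Rmin_left, Rmax_right by lra. unfold del in *; lra. }
  rewrite Rmin_left, Rmax_right in Ixi by lra.
  assert (Hxi2 : xi < x2).
  { destruct (Rle_lt_or_eq_dec xi x2) as [|E]; [lra|assumption|].
    rewrite E in Exi. unfold del in *; lra. }
  assert (Hxi1 : x1 < xi).
  { destruct (Rle_lt_or_eq_dec x1 xi) as [|E]; [lra|assumption|].
    rewrite <- E in Exi. unfold del in *; lra. }
  assert (Hd4 : 0 < del / 4) by lra.
  destruct (proj1 (continuity_pt_locally phi xi) (Hphi xi) (mkposreal _ Hd4))
    as (eta & Heta).
  simpl in Heta.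
  set (b := Rmin (xi + eta / 2) ((xi + x2) / 2)).
  assert (Hb : xi < b /\ b <= xi + eta / 2 /\ b < x2).
  { pose proof (cond_pos eta). unfold b, Rmin; destruct Rle_dec; lra. }
  assert (Hab : forall x, xi <= x <= b -> phi x1 + del / 4 < phi x < phi x2 - del / 4).
  { intros x Ix. assert (K : Rabs (x - xi) < eta).
    { pose proof (cond_pos eta). apply Rabs_def1; lra. }
    specialize (Heta x K). apply Rabs_def2 in Heta. unfold del in *; lra. }
  assert (Hmono : forall u v y, u < v -> y0 <= y -> phi v - phi u <= theta (v, y) - theta (u, y)).
  { intros u v y Huv Hy. destruct (Rle_lt_or_eq_dec _ _ Hy) as [Hy'| <-]; [|apply Rle_refl].
    assert (K := Hsg 0 u v y0 y Huv Hy').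
    unfold box_diff in K. unfold phi.
    enough (0 * ((v - u) * (y - y0)) <= theta (v, y) - theta (u, y) - theta (v, y0) + theta (u, y0)) by lra.
    apply K. intros x t _ _. apply Rlt_le, sin_gt_0; apply Hr. }
  assert (Hdpi : del < PI).
  { unfold del, phi. pose proof (Hr (x1, y0)). pose proof (Hr (x2, y0)). lra. }
  assert (Hsd : 0 < sin (del / 4)) by (apply sin_gt_0; lra).
  pose proof PI_RGT_0 as Hpi.
  assert (Hprod : 0 < sin (del / 4) * (b - xi)) by (apply Rmult_lt_0_compat; lra).
  set (Y := y0 + 2 * PI / (sin (del / 4) * (b - xi))).
  assert (HY : y0 < Y).
  { unfold Y. assert (0 < 2 * PI / (sin (del / 4) * (b - xi))) by (apply Rdiv_lt_0_compat; lra). lra. }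
  assert (K : sin (del / 4) * ((b - xi) * (Y - y0)) <= box_diff theta xi b y0 Y).
  { apply Hsg; [lra|lra|]. intros x y Ix Iy. apply sin_ge_away_from_endpoints; [lra|].
    assert (K1 := Hmono x1 x y ltac:(lra) ltac:(lra)).
    assert (K2 := Hmono x x2 y ltac:(lra) ltac:(lra)).
    pose proof (Hab x Ix). pose proof (Hr (x1, y)). pose proof (Hr (x2, y)).
    lra. }
  replace (sin (del / 4) * ((b - xi) * (Y - y0))) with (2 * PI) in K
    by (unfold Y; field; split; lra).
  unfold box_diff in K.
  pose proof (Hr (b, Y)). pose proof (Hr (xi, Y)).
  pose proof (Hr (b, y0)). pose proof (Hr (xi, y0)). lra.
Qed.

(** On a small square the mixed difference is positive, so [theta] increases
along its upper side or decreases along its lower side; the second case becomes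
the first one under the point reflection, which preserves the inequality. *)
Lemma sine_gordon_inequality_not_on_plane (theta : R2 -> R) :
  (forall p, 0 < theta p < PI) -> (forall p, continuous theta p) ->
  ~ sine_gordon_inequality theta.
Proof.
  intros Hr Hc Hsg.
  assert (Hs0 : 0 < sin (theta (0, 0))) by (apply sin_gt_0; apply Hr).
  destruct (continuous_box (fun z => sin (theta z)) (0, 0) (sin (theta (0, 0)) / 2))
    as (d & Hd & K).
  { apply continuous_of_continuity_pt; [apply Hc | apply continuity_sin]. }
  { lra. }
  set (r := d / 2).
  assert (Hbox : sin (theta (0, 0)) / 2 * ((r - 0) * (r - 0)) <= box_diff theta 0 r 0 r).
  { apply Hsg; [unfold r; lra | unfold r; lra |]. intros x y Ix Iy.
    specialize (K x y). simpl in K.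
    assert (K' := K ltac:(apply Rabs_def1; unfold r in *; lra)
                    ltac:(apply Rabs_def1; unfold r in *; lra)).
    apply Rabs_def2 in K'. lra. }
  assert (Hpos : 0 < sin (theta (0, 0)) / 2 * ((r - 0) * (r - 0))) by (apply Rmult_lt_0_compat; [lra | apply Rmult_lt_0_compat; unfold r; lra]).
  unfold box_diff in Hbox.
  destruct (Rlt_le_dec (theta (0, r)) (theta (r, r))) as [Hup|Hup].
  - apply (sine_gordon_no_increase theta Hr Hc Hsg 0 r r); [unfold r; lra | exact Hup].
  - apply (sine_gordon_no_increase (fun z => theta (- fst z, - snd z))) with (- r) 0 0.
    + intros p; apply Hr.
    + intros p. apply filterlim_locally. intros eps.
      destruct (continuous_box theta (- fst p, - snd p) eps (Hc _) (cond_pos eps))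
        as (d' & Hd' & K').
      exists (mkposreal d' Hd'). intros z (Z1 & Z2).
      assert (E : forall u v, Rabs (- u - - v) = Rabs (u - v)).
      { intros u v. rewrite <- Rabs_Ropp. f_equal; ring. }
      apply (K' (- fst z) (- snd z)); simpl; rewrite E; [exact Z1 | exact Z2].
    + intros s x1 x2 y1 y2 Hx Hy Hs.
      assert (L := Hsg s (- x2) (- x1) (- y2) (- y1) ltac:(lra) ltac:(lra)).
      unfold box_diff in *; simpl.
      assert (L' : s * ((- x1 - - x2) * (- y1 - - y2)) <=
         theta (- x1, - y1) - theta (- x2, - y1) - theta (- x1, - y2) + theta (- x2, - y2)).
      { apply L. intros x y Ix Iy. specialize (Hs (- x) (- y)). simpl in Hs.
        rewrite !Ropp_involutive in Hs. apply Hs; lra. }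
      lra.
    + unfold r; lra.
    + simpl. rewrite Ropp_involutive, Ropp_0. lra.
Qed.

Lemma no_parallel_net_on_plane U V N theta : ~ parallel_net U V N theta.
Proof.
  intros H.
  apply (sine_gordon_inequality_not_on_plane theta (net_angle _ _ _ _ H)
    (net_theta_continuous _ _ _ _ H)).
  unfold sine_gordon_inequality. apply (box_diff_ge theta (fun z => sin (theta z))).
  intros p eps Heps. apply (box_diff_angle_local U V N theta H p eps Heps).
Qed.

(** * Asymptotic Chebyshev immersions give parallel nets *)

Lemma chebyshev_cos u v t : dot u u = 1 -> dot v v = 1 -> is_angle u v t -> dot u v = cos t.
Proof. intros H1 H2 H. unfold is_angle, norm3 in H. rewrite H, H1, H2, sqrt_1. ring. Qed.

(** With [n] the normalised cross product, [cross n] is the rotation by a right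
angle in the tangent plane, so [v] is [u] rotated by the angle [t]. *)
Lemma unit_normal_frame u v n t :
  dot u u = 1 -> dot v v = 1 -> dot u v = cos t -> sin t <> 0 ->
  n = scal (/ sin t) (cross u v) ->
  dot n n = 1 /\ dot u n = 0 /\ cross u v = scal (sin t) n /\
  v = plus (scal (cos t) u) (scal (sin t) (cross n u)).
Proof.
  intros Hu Hv Huv Hs ->.
  pose proof (sin2_cos2 t) as E; unfold Rsqr in E.
  repeat split.
  - rewrite dot_scal_l, dot_comm, dot_scal_l, dot_cross_cross, (dot_comm v u), Hu, Hv, Huv.
    replace (1 * 1 - cos t * cos t) with (sin t * sin t) by lra.
    field; assumption.
  - rewrite dot_comm, dot_scal_l, dot_comm, dot_cross_self. ring.
  - apply R3_ext; vec_unfold; field; assumption.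
  - assert (Hc : cross (cross u v) u = plus v (scal (- cos t) u)).
    { rewrite cross_cross_l, Hu, (dot_comm v u), Huv.
      apply R3_ext; vec_unfold; ring. }
    replace (cross (scal (/ sin t) (cross u v)) u)
      with (scal (/ sin t) (cross (cross u v) u)).
    + rewrite Hc. apply R3_ext; vec_unfold; field; assumption.
    + apply R3_ext; vec_unfold; ring.
Qed.

Lemma dot_derive_unit F t F' :
  (forall s, dot (F s) (F s) = 1) -> is_derive3 F t F' -> dot (F t) F' = 0.
Proof.
  intros H1 HF.
  pose proof (is_derive_dot F F t F' F' HF HF) as K.
  assert (K0 : is_derive (fun s => dot (F s) (F s)) t 0).
  { apply (is_derive_ext (fun _ => 1)); [intros; now rewrite H1 | exact (is_derive_const _ t)]. }
  pose proof (is_derive_unique _ _ _ K) as E1. rewrite (is_derive_unique _ _ _ K0) in E1.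
  rewrite (dot_comm F') in E1. lra.
Qed.

(** Since [N] has unit length, [f_x = N x N_x] and [f_y = - N x N_y] invert to
[N_x = f_x x N] and [N_y = N x f_y]. Differentiating [f_x = N x N_x] in [y]
leaves only [N_y x N_x], because [N_xy] is parallel to [N]; the same vector
comes out of [f_y], and it equals [sin theta N]. *)
Lemma parallel_net_of_asymptotic_chebyshev (f N : R2 -> R3) (theta : R2 -> R) :
  (forall p, continuous (dx f) p /\ continuous (dy f) p) ->
  (forall p, dot (dx f p) (dx f p) = 1 /\ dot (dy f p) (dy f p) = 1) ->
  (forall p, 0 < theta p < PI /\ is_angle (dx f p) (dy f p) (theta p)) ->
  (forall p, N p = scal (/ sin (theta p)) (cross (dx f p) (dy f p))) ->
  (forall p, ex_dx N p /\ ex_dy N p /\ ex_dy (dx N) p /\ ex_dx (dy N) p) ->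
  (forall p, dxy N p = scal (cos (theta p)) (N p) /\
             dyx N p = scal (cos (theta p)) (N p)) ->
  (forall p, dx f p = cross (N p) (dx N p)) ->
  (forall p, dy f p = opp (cross (N p) (dy N p))) ->
  parallel_net (dx f) (dy f) N theta.
Proof.
  intros Hc Hu Ht HN HdN HNxy Hfx Hfy.
  assert (Hs : forall p, 0 < sin (theta p)).
  { intros p; destruct (Ht p) as [[? ?] _]; apply sin_gt_0; assumption. }
  assert (Hcos : forall p, dot (dx f p) (dy f p) = cos (theta p)).
  { intros p; exact (chebyshev_cos _ _ _ (proj1 (Hu p)) (proj2 (Hu p)) (proj2 (Ht p))). }
  assert (HF : forall p, dot (N p) (N p) = 1 /\ dot (dx f p) (N p) = 0 /\
     cross (dx f p) (dy f p) = scal (sin (theta p)) (N p) /\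
     dy f p = plus (scal (cos (theta p)) (dx f p)) (scal (sin (theta p)) (cross (N p) (dx f p)))).
  { intros p. exact (unit_normal_frame _ _ _ _ (proj1 (Hu p)) (proj2 (Hu p)) (Hcos p)
      (Rgt_not_eq _ _ (Hs p)) (HN p)). }
  assert (HcU : forall p, continuous3 (dx f) p) by (intros p; exact (continuous3_intro _ p (proj1 (Hc p)))).
  assert (HcV : forall p, continuous3 (dy f) p) by (intros p; exact (continuous3_intro _ p (proj2 (Hc p)))).
  (* Continuity is not assumed: theta is recovered as the arc cosine of the
     scalar product of the tangents. *)
  assert (HcT : forall p, continuous theta p).
  { intros p. apply (continuous_ext (fun z => acos (dot (dx f z) (dy f z)))).
    - intros z. rewrite Hcos. apply acos_cos. pose proof (Ht z). lra.
    - apply continuous_of_continuity_pt; [exact (continuous_dot _ _ p (HcU p) (HcV p))|].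
      rewrite Hcos. apply derivable_continuous_pt, derivable_pt_acos.
      pose proof (sin2_cos2 (theta p)) as E; unfold Rsqr in E. pose proof (Hs p). nra. }
  assert (HNx : forall x y, dx N (x, y) = cross (dx f (x, y)) (N (x, y))).
  { intros x y. rewrite Hfx, cross_cross_l, (proj1 (HF (x, y))).
    assert (E : dot (N (x, y)) (dx N (x, y)) = 0).
    { apply (dot_derive_unit (fun t => N (t, y))); [intros; exact (proj1 (HF _))|].
      (apply is_derive3_dx; destruct (HdN (x, y)) as (?&?&?&?); assumption). }
    rewrite dot_comm, E. apply R3_ext; vec_unfold; ring. }
  assert (HNy : forall x y, dy N (x, y) = cross (N (x, y)) (dy f (x, y))).
  { intros x y. rewrite Hfy.
    replace (cross (N (x, y)) (opp (cross (N (x, y)) (dy N (x, y)))))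
      with (cross (cross (N (x, y)) (dy N (x, y))) (N (x, y)))
      by (apply R3_ext; vec_unfold; ring).
    rewrite cross_cross_l, (proj1 (HF (x, y))).
    assert (E : dot (N (x, y)) (dy N (x, y)) = 0).
    { apply (dot_derive_unit (fun t => N (x, t))); [intros; exact (proj1 (HF _))|].
      (apply is_derive3_dy; destruct (HdN (x, y)) as (?&?&?&?); assumption). }
    rewrite dot_comm, E. apply R3_ext; vec_unfold; ring. }
  assert (HNyx : forall x y, cross (dy N (x, y)) (dx N (x, y)) =
                   scal (sin (theta (x, y))) (N (x, y))).
  { intros x y. rewrite HNx, HNy. destruct (HF (x, y)) as (E1 & E2 & E3 & _).
    rewrite cross_cross_l.
    assert (E4 : dot (dy f (x, y)) (cross (dx f (x, y)) (N (x, y))) =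
       - dot (cross (dx f (x, y)) (dy f (x, y))) (N (x, y)))
      by (unfold dot, cross, c1, c2, c3; simpl; ring).
    assert (E5 : dot (N (x, y)) (cross (dx f (x, y)) (N (x, y))) = 0)
      by (unfold dot, cross, c1, c2, c3; simpl; ring).
    rewrite E4, E5, E3, dot_scal_l, E1. apply R3_ext; vec_unfold; ring. }
  split.
  - intros p. exact (proj1 (Ht p)).
  - exact HcT.
  - exact HcU.
  - exact HcV.
  - intros p. apply (continuous3_ext
      (fun z => scal (/ sin (theta z)) (cross (dx f z) (dy f z)))); [intros; now rewrite HN|].
    assert (K : continuous (fun z => / sin (theta z)) p).
    { apply (continuous_comp (fun z => sin (theta z)) Rinv).
      - apply continuous_of_continuity_pt; [apply HcT | apply continuity_sin].
      - apply (continuous_Rinv (sin (theta p))), Rgt_not_eq, Hs. }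
    destruct (continuous3_cross (dx f) (dy f) p (HcU p) (HcV p)) as (K1 & K2 & K3).
    split; [|split].
    + exact (continuous_Rmult _ _ p K K1).
    + exact (continuous_Rmult _ _ p K K2).
    + exact (continuous_Rmult _ _ p K K3).
  - intros p. exact (proj1 (Hu p)).
  - intros p. exact (proj1 (HF p)).
  - intros p. exact (proj1 (proj2 (HF p))).
  - intros p. exact (proj2 (proj2 (proj2 (HF p)))).
  - intros x y. rewrite <- HNx. (apply is_derive3_dx; destruct (HdN (x, y)) as (?&?&?&?); assumption).
  - intros x y. rewrite <- HNy. (apply is_derive3_dy; destruct (HdN (x, y)) as (?&?&?&?); assumption).
  - intros x y. rewrite <- HNyx.
    apply (is_derive3_ext (fun t => cross (N (x, t)) (dx N (x, t)))); [intros; now rewrite Hfx|].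
    replace (cross (dy N (x, y)) (dx N (x, y))) with
      (plus (cross (dy N (x, y)) (dx N (x, y))) (cross (N (x, y)) (dxy N (x, y)))).
    + apply (is_derive3_cross (fun t => N (x, t)) (fun t => dx N (x, t)));
        (apply is_derive3_dy; destruct (HdN (x, y)) as (?&?&?&?); assumption).
    + rewrite (proj1 (HNxy (x, y))). apply R3_ext; vec_unfold; ring.
  - intros x y. rewrite <- HNyx.
    apply (is_derive3_ext (fun t => cross (dy N (t, y)) (N (t, y)))).
    { intros; now rewrite Hfy, cross_anticomm. }
    replace (cross (dy N (x, y)) (dx N (x, y))) with
      (plus (cross (dyx N (x, y)) (N (x, y))) (cross (dy N (x, y)) (dx N (x, y)))).
    + apply (is_derive3_cross (fun t => dy N (t, y)) (fun t => N (t, y)));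
        (apply is_derive3_dx; destruct (HdN (x, y)) as (?&?&?&?); assumption).
    + rewrite (proj2 (HNxy (x, y))). apply R3_ext; vec_unfold; ring.
Qed.

(** * A lower bound for the length of paths ending at a point *)

(** Squaring the positive part makes it continuously differentiable. *)
Definition pos_sq (u : R) : R := Rmax 0 u ^ 2.

Lemma is_derive_pos_sq u : is_derive pos_sq u (2 * Rmax 0 u).
Proof.
  apply is_derive_Reals. intros eps Heps.
  exists (mkposreal eps Heps). intros h Hh Hlt. simpl in Hlt.
  assert (K : Rabs (pos_sq (u + h) - pos_sq u - 2 * Rmax 0 u * h) <= h * h).
  { unfold pos_sq, Rmax. destruct (Rle_dec 0 (u + h)), (Rle_dec 0 u); apply Rabs_le; nra. }
  replace ((pos_sq (u + h) - pos_sq u) / h - 2 * Rmax 0 u) with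
    ((pos_sq (u + h) - pos_sq u - 2 * Rmax 0 u * h) / h) by (field; exact Hh).
  unfold Rdiv. rewrite Rabs_mult, Rabs_inv.
  assert (0 < Rabs h) by (apply Rabs_pos_lt, Hh).
  assert (E : h * h = Rabs h * Rabs h) by (rewrite <- Rabs_mult, Rabs_pos_eq; nra).
  apply Rle_lt_trans with (Rabs h * Rabs h * / Rabs h).
  - apply Rmult_le_compat_r; [apply Rlt_le, Rinv_0_lt_compat; assumption | lra].
  - rewrite Rmult_assoc, Rinv_r by lra. lra.
Qed.

(** A [C^1] bump supported in the interval from [- r] to [r]. *)
Definition bump (r s : R) : R := pos_sq (r ^ 2 - s ^ 2).
Definition bump' (r s : R) : R := - 4 * s * Rmax 0 (r ^ 2 - s ^ 2).

Lemma is_derive_bump r s : is_derive (bump r) s (bump' r s).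
Proof.
  replace (bump' r s) with ((0 - (1 * s + s * 1)) * (2 * Rmax 0 (r ^ 2 - s ^ 2)))
    by (unfold bump'; ring).
  apply (is_derive_comp pos_sq (fun s => r ^ 2 - s ^ 2)).
  - apply is_derive_pos_sq.
  - apply (is_derive_ext (fun s => r ^ 2 - s * s)); [intros t; simpl; ring|].
    apply is_derive_Rminus; [exact (is_derive_const _ s)|].
    apply is_derive_Rmult; exact (is_derive_id s).
Qed.

Lemma bump_outside r s : 0 < r -> r <= Rabs s -> bump r s = 0 /\ bump' r s = 0.
Proof.
  intros Hr H. assert (K : r ^ 2 - s ^ 2 <= 0).
  { rewrite <- (pow2_abs s). nra. }
  unfold bump, bump', pos_sq. rewrite Rmax_left by exact K. split; ring.
Qed.

Lemma bump_bound r s : 0 < r <= 1 -> Rabs (bump r s) <= 1 /\ Rabs (bump' r s) <= 4.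
Proof.
  intros Hr. destruct (Rle_lt_dec r (Rabs s)) as [H|H].
  - destruct (bump_outside r s) as (-> & ->); [lra | exact H |]. rewrite Rabs_R0; lra.
  - apply Rabs_def2 in H. unfold bump, bump', pos_sq.
    assert (K : 0 <= Rmax 0 (r ^ 2 - s ^ 2) <= 1) by (apply conj; unfold Rmax; destruct Rle_dec; nra).
    set (w := Rmax 0 (r ^ 2 - s ^ 2)) in *.
    split; apply Rabs_le; split; nra.
Qed.

Lemma continuous_bump r s : continuous (bump r) s.
Proof. apply (ex_derive_continuous (bump r) s). eexists; apply is_derive_bump. Qed.

Lemma continuous_bump' r s : continuous (bump' r) s.
Proof.
  unfold bump'. apply continuous_Rmult.
  - apply continuous_Rmult; [apply continuous_const | apply continuous_id].
  - apply (continuous_ext (fun s => (r ^ 2 - s ^ 2 + Rabs (r ^ 2 - s ^ 2)) / 2)).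
    + intros t. unfold Rmax, Rabs. destruct Rle_dec, Rcase_abs; lra.
    + assert (K : continuous (fun s => r ^ 2 - s ^ 2) s).
      { apply continuous_Rminus; [apply continuous_const|].
        apply continuous_pow2, continuous_id. }
      apply continuous_Rdiv; [|apply continuous_const|lra].
      apply continuous_Rplus; [exact K|].
      apply (continuous_comp (fun s => r ^ 2 - s ^ 2) Rabs); [exact K|].
      apply continuous_Rabs.
Qed.

Lemma continuous_fst_comp {T : UniformSpace} (c : T -> R2) x :
  continuous c x -> continuous (fun z => fst (c z)) x.
Proof.
  intros H. apply (continuous_comp c fst); [exact H|].
  rewrite (surjective_pairing (c x)). apply continuous_fst.
Qed.

Lemma continuous_snd_comp {T : UniformSpace} (c : T -> R2) x :
  continuous c x -> continuous (fun z => snd (c z)) x.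
Proof.
  intros H. apply (continuous_comp c snd); [exact H|].
  rewrite (surjective_pairing (c x)). apply continuous_snd.
Qed.

Lemma continuous_speed (f : R2 -> R3) (c c' : R -> R2) t :
  continuous (dx f) (c t) -> continuous (dy f) (c t) ->
  continuous c t -> continuous c' t ->
  continuous (fun s => sqrt (induced_metric f (c s) (c' s) (c' s))) t.
Proof.
  intros Hx Hy Hc Hc'.
  assert (K : continuous3 (fun s => differential f (c s) (c' s)) t).
  { destruct (continuous3_intro (fun s => dx f (c s)) t) as (X1 & X2 & X3).
    { apply (continuous_comp c (dx f)); assumption. }
    destruct (continuous3_intro (fun s => dy f (c s)) t) as (Y1 & Y2 & Y3).
    { apply (continuous_comp c (dy f)); assumption. }
    pose proof (continuous_fst_comp c' t Hc') as C1.
    pose proof (continuous_snd_comp c' t Hc') as C2.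
    split; [|split].
    - exact (continuous_Rplus _ _ t (continuous_Rmult _ _ t C1 X1) (continuous_Rmult _ _ t C2 Y1)).
    - exact (continuous_Rplus _ _ t (continuous_Rmult _ _ t C1 X2) (continuous_Rmult _ _ t C2 Y2)).
    - exact (continuous_Rplus _ _ t (continuous_Rmult _ _ t C1 X3) (continuous_Rmult _ _ t C2 Y3)). }
  apply (continuous_comp (fun s => induced_metric f (c s) (c' s) (c' s)) sqrt).
  - exact (continuous_dot _ _ t K K).
  - apply continuous_sqrt.
Qed.

(** A function whose gradient [(hx, hy)] is dominated by the metric cannot grow
along a path by more than the length. The bound passes to concatenations by
adding up. *)
Lemma barrier_le_length (D : R2 -> Prop) (f : R2 -> R3) (h hx hy : R2 -> R) :
  (forall p, D p -> continuous (dx f) p /\ continuous (dy f) p) ->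
  (forall (c : R -> R2) t c', is_derive c t c' ->
     is_derive (fun s => h (c s)) t (hx (c t) * fst c' + hy (c t) * snd c')) ->
  (forall p, continuous hx p /\ continuous hy p) ->
  (forall p v, D p -> hx p * fst v + hy p * snd v <= sqrt (induced_metric f p v v)) ->
  forall p q l, path_length D (induced_metric f) p q l -> h q - h p <= l.
Proof.
  intros Hf Hh Hc Hle p q l Hl.
  induction Hl as [a b c c' Hab Harc | p q r l1 l2 _ IH1 _ IH2]; [|lra].
  assert (Hcc : forall t, a <= t <= b -> continuous c t).
  { intros t Ht. apply (ex_derive_continuous c t). exists (c' t). apply Harc, Ht. }
  assert (HR : is_RInt (fun t => hx (c t) * fst (c' t) + hy (c t) * snd (c' t)) a b
                 (minus (h (c b)) (h (c a)))).
  { apply (is_RInt_derive (fun t => h (c t)));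
      rewrite Rmin_left, Rmax_right by exact Hab; intros t Ht.
    - apply Hh. apply Harc, Ht.
    - destruct (Harc t Ht) as (_ & _ & K).
      apply continuous_Rplus; apply continuous_Rmult.
      + apply (continuous_comp c hx); [apply Hcc, Ht | apply Hc].
      + apply continuous_fst_comp, K.
      + apply (continuous_comp c hy); [apply Hcc, Ht | apply Hc].
      + apply continuous_snd_comp, K. }
  change (h (c b) - h (c a)) with (minus (h (c b)) (h (c a))).
  rewrite <- (is_RInt_unique _ _ _ _ HR).
  apply RInt_le; [exact Hab | eexists; exact HR | |].
  - apply (ex_RInt_continuous (V := R_CompleteNormedModule)).
    rewrite Rmin_left, Rmax_right by exact Hab. intros t Ht.
    destruct (Harc t Ht) as (Dt & _ & K). destruct (Hf _ Dt).
    apply continuous_speed; auto.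
  - intros t Ht. apply Hle. apply Harc; lra.
Qed.

Lemma induced_metric_chebyshev f p v :
  dot (dx f p) (dx f p) = 1 -> dot (dy f p) (dy f p) = 1 ->
  induced_metric f p v v =
    fst v ^ 2 + snd v ^ 2 + 2 * (fst v * snd v) * dot (dx f p) (dy f p).
Proof.
  intros H1 H2. unfold induced_metric, differential.
  rewrite dot_plus_l, !dot_scal_l, (dot_comm (dx f p)), (dot_comm (dy f p)),
    !dot_plus_l, !dot_scal_l, H1, H2, (dot_comm (dy f p) (dx f p)). ring.
Qed.

(** The metric of a Chebyshev net stays comparable to the Euclidean one as long
as the cosine of the angle keeps away from 1 and -1. *)
Lemma quadratic_form_lower_bound kappa C v1 v2 :
  0 <= kappa < 1 -> Rabs C <= kappa ->
  (1 - kappa) / 2 * (Rabs v1 + Rabs v2) <= sqrt (v1 ^ 2 + v2 ^ 2 + 2 * (v1 * v2) * C).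
Proof.
  intros Hk HC.
  assert (A : Rabs (v1 * v2 * C) <= Rabs v1 * Rabs v2 * kappa).
  { rewrite !Rabs_mult. apply Rmult_le_compat_l; [|exact HC].
    apply Rmult_le_pos; apply Rabs_pos. }
  pose proof (Rle_abs (- (v1 * v2 * C))) as A'. rewrite Rabs_Ropp in A'.
  pose proof (Rabs_pos v1). pose proof (Rabs_pos v2).
  rewrite <- (pow2_abs v1), <- (pow2_abs v2).
  set (a := Rabs v1) in *. set (b := Rabs v2) in *.
  rewrite <- (sqrt_pow2 ((1 - kappa) / 2 * (a + b))) by nra.
  apply sqrt_le_1_alt.
  assert (B : (1 - kappa) * (a ^ 2 + b ^ 2) <= a ^ 2 + b ^ 2 + 2 * (v1 * v2) * C).
  { pose proof (pow2_ge_0 (a - b)). nra. }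
  apply Rle_trans with (2 := B).
  assert (((1 - kappa) / 2 * (a + b)) ^ 2 = (1 - kappa) * ((1 - kappa) / 4 * (a + b) ^ 2)) as ->
    by field.
  apply Rmult_le_compat_l; [lra|].
  pose proof (pow2_ge_0 (a - b)). pose proof (pow2_ge_0 (a + b)). nra.
Qed.

(** The barrier is a product of bumps in the two coordinates around [p], scaled
down until its gradient is dominated by the metric. It vanishes at the starting
point of the path and is positive at [p]. *)
Lemma path_length_from_outside D f p rho :
  (forall z, D z -> continuous (dx f) z /\ continuous (dy f) z) ->
  chebyshev D f -> D p -> Rabs (dot (dx f p) (dy f p)) < 1 -> 0 < rho ->
  exists delta, 0 < delta /\ forall z l,
    rho <= Rabs (fst z - fst p) \/ rho <= Rabs (snd z - snd p) ->
    path_length D (induced_metric f) z p l -> delta <= l.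
Proof.
  intros Hf Hche Dp Hp Hrho.
  set (C := fun z => dot (dx f z) (dy f z)). fold (C p) in Hp.
  set (kappa := (1 + Rabs (C p)) / 2).
  pose proof (Rabs_pos (C p)) as HCp.
  assert (HcC : continuous C p).
  { destruct (Hf p Dp). apply continuous_dot; apply continuous3_intro; assumption. }
  destruct (continuous_box C p (kappa - Rabs (C p)) HcC) as (d & Hd & Hbox);
    [unfold kappa; lra|].
  set (r := Rmin (Rmin d rho) 1).
  assert (Hr : 0 < r /\ r <= d /\ r <= rho /\ r <= 1).
  { unfold r, Rmin; repeat destruct Rle_dec; lra. }
  (* The partial derivatives of the product of bumps are at most 4, and the
     metric dominates (1 - kappa) / 2 times the sum of the absolute values of
     the components of a vector. *)
  set (k := (1 - kappa) / 8).
  assert (Hk : 0 < k) by (unfold k, kappa; lra).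
  set (bumpx := fun z : R2 => bump r (fst z - fst p)).
  set (bumpy := fun z : R2 => bump r (snd z - snd p)).
  set (dbumpx := fun z : R2 => bump' r (fst z - fst p)).
  set (dbumpy := fun z : R2 => bump' r (snd z - snd p)).
  set (h := fun z => k * (bumpx z * bumpy z)).
  set (hx := fun z => k * (dbumpx z * bumpy z)).
  set (hy := fun z => k * (bumpx z * dbumpy z)).
  assert (Hsx : forall z : R2, continuous (fun z => fst z - fst p) z).
  { intros z. apply continuous_Rminus; [|apply continuous_const].
    apply (continuous_fst_comp (fun z => z)), continuous_id. }
  assert (Hsy : forall z : R2, continuous (fun z => snd z - snd p) z).
  { intros z. apply continuous_Rminus; [|apply continuous_const].
    apply (continuous_snd_comp (fun z => z)), continuous_id. }
  assert (Hbx : forall z, continuous bumpx z)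
    by (intros z; apply (continuous_comp _ (bump r) z (Hsx z)), continuous_bump).
  assert (Hby : forall z, continuous bumpy z)
    by (intros z; apply (continuous_comp _ (bump r) z (Hsy z)), continuous_bump).
  assert (Hbx' : forall z, continuous dbumpx z)
    by (intros z; apply (continuous_comp _ (bump' r) z (Hsx z)), continuous_bump').
  assert (Hby' : forall z, continuous dbumpy z)
    by (intros z; apply (continuous_comp _ (bump' r) z (Hsy z)), continuous_bump').
  assert (Hout : forall z, r <= Rabs (fst z - fst p) \/ r <= Rabs (snd z - snd p) ->
             h z = 0 /\ hx z = 0 /\ hy z = 0).
  { unfold h, hx, hy, bumpx, bumpy, dbumpx, dbumpy. intros z [Hz|Hz];
      destruct (bump_outside r _ (proj1 Hr) Hz) as (-> & ->);
      (split; [|split]); ring. }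
  assert (Hhp : 0 < h p).
  { unfold h, bumpx, bumpy, bump, pos_sq. rewrite !Rminus_diag, Rmax_right by nra.
    apply Rmult_lt_0_compat; [exact Hk|].
    assert (0 < r ^ 2 - 0 ^ 2) by nra.
    apply Rmult_lt_0_compat; apply pow_lt; assumption. }
  exists (h p). split; [exact Hhp|]. intros z l Hz Hl.
  assert (K := barrier_le_length D f h hx hy Hf).
  assert (Hz0 : h z = 0) by (apply Hout; destruct Hz; [left|right]; lra).
  enough (h p - h z <= l) by lra.
  apply K; [ | | | exact Hl].
  - intros c t c' Hc.
    assert (D1 : is_derive (fun s => fst (c s) - fst p) t (fst c')).
    { rewrite <- (Rminus_0_r (fst c')). apply is_derive_Rminus; [|exact (is_derive_const _ t)].
      exact (is_derive_linear c fst t c' is_linear_fst Hc). }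
    assert (D2 : is_derive (fun s => snd (c s) - snd p) t (snd c')).
    { rewrite <- (Rminus_0_r (snd c')). apply is_derive_Rminus; [|exact (is_derive_const _ t)].
      exact (is_derive_linear c snd t c' is_linear_snd Hc). }
    pose proof (is_derive_comp (bump r) _ t _ _ (is_derive_bump r _) D1) as B1.
    pose proof (is_derive_comp (bump r) _ t _ _ (is_derive_bump r _) D2) as B2.
    pose proof (is_derive_Rmult _ _ t _ _ B1 B2) as B3.
    pose proof (is_derive_Rmult (fun _ => k) _ t 0 _ (is_derive_const k t) B3) as B4.
    replace (hx (c t) * fst c' + hy (c t) * snd c') with
      (0 * (bumpx (c t) * bumpy (c t)) +
       k * (fst c' * dbumpx (c t) * bumpy (c t) + bumpx (c t) * (snd c' * dbumpy (c t))))
      by (unfold hx, hy; ring).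
    exact B4.
  - intros z'. split; (apply continuous_Rmult; [apply continuous_const|]);
      apply continuous_Rmult; auto.
  - intros z' v Dz. destruct (Hche z' Dz) as (H1 & H2).
    rewrite induced_metric_chebyshev by assumption. fold (C z').
    destruct (Rle_lt_dec r (Rabs (fst z' - fst p))) as [Hx|Hx];
      [|destruct (Rle_lt_dec r (Rabs (snd z' - snd p))) as [Hy|Hy]].
    + destruct (Hout z' (or_introl Hx)) as (_ & -> & ->).
      rewrite !Rmult_0_l, Rplus_0_r. apply sqrt_pos.
    + destruct (Hout z' (or_intror Hy)) as (_ & -> & ->).
      rewrite !Rmult_0_l, Rplus_0_r. apply sqrt_pos.
    + assert (HC : Rabs (C z') <= kappa).
      { destruct z' as [x y]; simpl in *.
        specialize (Hbox x y ltac:(lra) ltac:(lra)).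
        pose proof (Rabs_triang_inv (C (x, y)) (C p)). lra. }
      apply Rle_trans with (2 := quadratic_form_lower_bound kappa (C z') (fst v) (snd v)
        ltac:(unfold kappa; lra) HC).
      assert (M : forall a b w, Rabs a <= 4 -> Rabs b <= 1 -> k * (a * b) * w <= 4 * k * Rabs w).
      { intros a b w Ha Hb.
        apply Rle_trans with (1 := Rle_abs _). rewrite !Rabs_mult, (Rabs_pos_eq k) by lra.
        pose proof (Rabs_pos a). pose proof (Rabs_pos b). pose proof (Rabs_pos w).
        assert (Rabs a * Rabs b <= 4 * 1) by (apply Rmult_le_compat; lra).
        apply Rmult_le_compat_r; nra. }
      destruct (bump_bound r (fst z' - fst p)) as (P1 & P2); [lra|].
      destruct (bump_bound r (snd z' - snd p)) as (P3 & P4); [lra|].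
      assert (M1 := M (dbumpx z') (bumpy z') (fst v) P2 P3).
      assert (M2 := M (dbumpy z') (bumpx z') (snd v) P4 P1).
      unfold hx, hy. rewrite (Rmult_comm (bumpx z')).
      replace ((1 - kappa) / 2 * (Rabs (fst v) + Rabs (snd v))) with
        (4 * k * Rabs (fst v) + 4 * k * Rabs (snd v)) by (unfold k; field).
      lra.
Qed.

(** * Completeness forces the domain to be the plane *)

(** Nonnegativity of [l] covers the case of an infimum equal to minus infinity,
whose real part is 0. *)
Lemma riem_dist_le D g p q l : path_length D g p q l -> 0 <= l -> riem_dist D g p q <= l.
Proof.
  intros Hl H0. unfold riem_dist.
  destruct (Glb_Rbar_correct (path_length D g p q)) as (Hlow & _).
  specialize (Hlow l Hl). destruct (Glb_Rbar _); simpl in *; lra.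
Qed.

(** Some path must exist, since the empty infimum has real part 0. *)
Lemma riem_dist_ge D g p q delta :
  (exists l, path_length D g p q l) ->
  (forall l, path_length D g p q l -> delta <= l) -> delta <= riem_dist D g p q.
Proof.
  intros (l & Hl) Hge. unfold riem_dist.
  destruct (Glb_Rbar_correct (path_length D g p q)) as (Hlow & Hgreat).
  specialize (Hlow l Hl). specialize (Hgreat (Finite delta) Hge).
  destruct (Glb_Rbar _); simpl in *; lra || contradiction.
Qed.

Definition line (z e : R2) (t : R) : R2 := (fst z + t * fst e, snd z + t * snd e).

Definition axis_direction (e : R2) : Prop := fst e * snd e = 0 /\ fst e ^ 2 + snd e ^ 2 = 1.

Lemma is_derive_line z e t : is_derive (line z e) t e.
Proof.
  pose (V := prod_NormedModule R_AbsRing R_NormedModule R_NormedModule).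
  apply (is_derive_ext (fun s => @plus V z (@scal _ V s e))); [reflexivity|].
  assert (K : is_derive (V := V) (fun s => @plus V z (@scal _ V s e)) t (@plus V zero e)).
  { apply (is_derive_plus (V := V)); [exact (is_derive_const (V := V) z t)|].
    exact (filterdiff_linear (fun s => @scal _ V s e) (is_linear_scal_l (V := V) e)). }
  rewrite (@plus_zero_l V e) in K. exact K.
Qed.

Lemma axis_path_forward D f z e s s' :
  chebyshev D f -> axis_direction e -> s <= s' ->
  (forall t, s <= t <= s' -> D (line z e t)) ->
  path_length D (induced_metric f) (line z e s) (line z e s') (s' - s).
Proof.
  intros Hche (He & He1) Hs HD.
  replace (s' - s) with
    (RInt (fun t => sqrt (induced_metric f (line z e t) e e)) s s').
  - apply (path_arc D (induced_metric f) s s' (line z e) (fun _ => e) Hs).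
    intros t Ht. split; [apply HD, Ht|].
    split; [apply is_derive_line | apply continuous_const].
  - rewrite (RInt_ext _ (fun _ => 1)).
    + rewrite RInt_const. apply Rmult_1_r.
    + rewrite Rmin_left, Rmax_right by exact Hs. intros t Ht.
      destruct (Hche (line z e t)) as (H1 & H2); [apply HD; lra|].
      rewrite induced_metric_chebyshev, He, He1 by assumption.
      rewrite Rmult_0_r, Rmult_0_l, Rplus_0_r. apply sqrt_1.
Qed.

(** Coordinate curves have unit speed, so lengths along them are differences of
parameters. *)
Lemma axis_path D f z e s s' :
  chebyshev D f -> axis_direction e ->
  (forall t, Rmin s s' <= t <= Rmax s s' -> D (line z e t)) ->
  path_length D (induced_metric f) (line z e s) (line z e s') (Rabs (s' - s)).
Proof.
  intros Hche He HD. destruct (Rle_lt_dec s s') as [H|H].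
  - rewrite Rmin_left, Rmax_right in HD by lra. rewrite Rabs_pos_eq by lra.
    apply axis_path_forward; assumption.
  - rewrite Rmin_right, Rmax_left in HD by lra. rewrite Rabs_left by lra.
    assert (E : forall t, line z e t = line z (- fst e, - snd e) (- t))
      by (intros t; unfold line; simpl; f_equal; ring).
    rewrite (E s), (E s'). replace (- (s' - s)) with (- s' - - s) by ring.
    apply axis_path_forward; [exact Hche | | lra |].
    + destruct He; split; simpl; nra.
    + intros t Ht. rewrite <- (Ropp_involutive t), <- E. apply HD. lra.
Qed.

(** The points at parameters [T - T / (n + 1)] form a Cauchy sequence, because
parameters measure length. If the endpoint were not its limit [p], the sequence
would eventually stay outside a fixed square around [p], hence at distance from
[p] bounded below. *)
Lemma complete_axis_endpoint D f z e T :
  (forall z, D z -> continuous (dx f) z /\ continuous (dy f) z) ->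
  chebyshev D f -> (forall p, D p -> Rabs (dot (dx f p) (dy f p)) < 1) ->
  (forall p q, D p -> D q -> exists l, path_length D (induced_metric f) p q l) ->
  complete_metric D (induced_metric f) ->
  axis_direction e -> 0 < T -> (forall t, 0 <= t < T -> D (line z e t)) ->
  D (line z e T).
Proof.
  intros Hf Hche Hang Hconn Hcomp He HT HD.
  set (t := fun n : nat => T - T / INR (S n)).
  assert (Ht : forall n, 0 <= t n < T).
  { intros n. unfold t. assert (1 <= INR (S n)) by (rewrite S_INR; pose proof (pos_INR n); lra).
    assert (0 < T / INR (S n)) by (apply Rdiv_lt_0_compat; lra).
    assert (E : T / INR (S n) * INR (S n) = T) by (field; lra). nra. }
  assert (Hlim : forall eps, 0 < eps -> exists n0, forall n, (n0 <= n)%nat -> T - eps < t n).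
  { intros eps Heps. destruct (INR_archimed eps T Heps) as (n0 & Hn0).
    exists n0. intros n Hn. unfold t.
    assert (K : INR n0 < INR (S n)) by (apply lt_INR; lia).
    pose proof (pos_INR n0).
    assert (E : T / INR (S n) * INR (S n) = T) by (field; lra).
    assert (0 < T / INR (S n)) by (apply Rdiv_lt_0_compat; lra). nra. }
  destruct (Hcomp (fun n => line z e (t n))) as (p & Dp & Hp).
  { intros n. apply HD, Ht. }
  { intros eps Heps. destruct (Hlim eps Heps) as (n0 & Hn0). exists n0. intros m n Hm Hn.
    apply Rle_lt_trans with (Rabs (t n - t m)).
    - apply riem_dist_le; [|apply Rabs_pos].
      apply axis_path; [exact Hche | exact He |]. intros s Hs. apply HD.
      pose proof (Ht m). pose proof (Ht n).
      unfold Rmin, Rmax in Hs; repeat destruct Rle_dec; lra.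
    - pose proof (Ht m). pose proof (Ht n). specialize (Hn0 m Hm) as A1. specialize (Hn0 n Hn) as A2.
      apply Rabs_def1; lra. }
  set (L := line z e T) in *.
  destruct (Classical_Prop.classic (L = p)) as [->|HLp]; [exact Dp|exfalso].
  assert (He1 : Rabs (fst e) <= 1 /\ Rabs (snd e) <= 1).
  { destruct He as (_ & He). split; apply Rabs_le; nra. }
  assert (Hrho : exists rho, 0 < rho /\
     (2 * rho <= Rabs (fst L - fst p) \/ 2 * rho <= Rabs (snd L - snd p))).
  { destruct (Req_dec (fst L) (fst p)) as [E1|E1].
    - destruct (Req_dec (snd L) (snd p)) as [E2|E2].
      + exfalso; apply HLp. destruct L, p; simpl in *; congruence.
      + exists (Rabs (snd L - snd p) / 2).
        assert (0 < Rabs (snd L - snd p)) by (apply Rabs_pos_lt; lra). split; [lra|right; lra].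
    - exists (Rabs (fst L - fst p) / 2).
      assert (0 < Rabs (fst L - fst p)) by (apply Rabs_pos_lt; lra). split; [lra|left; lra]. }
  destruct Hrho as (rho & Hrho & Hout).
  destruct (path_length_from_outside D f p rho Hf Hche Dp (Hang p Dp) Hrho)
    as (delta & Hdelta & Hpath).
  destruct (Hlim rho Hrho) as (n1 & Hn1).
  apply is_lim_seq_spec in Hp. destruct (Hp (mkposreal delta Hdelta)) as (n2 & Hn2).
  set (n := Nat.max n1 n2).
  specialize (Hn1 n (Nat.le_max_l _ _)). specialize (Hn2 n (Nat.le_max_r _ _)).
  simpl in Hn2. rewrite Rminus_0_r in Hn2. pose proof (Ht n) as Htn.
  assert (Hclose : forall x w, Rabs w <= 1 -> Rabs ((x + T * w) - (x + t n * w)) <= rho).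
  { intros x w Hw. replace (_ - _) with ((T - t n) * w) by ring.
    rewrite Rabs_mult, (Rabs_pos_eq (T - t n)) by lra.
    pose proof (Rabs_pos w). nra. }
  assert (Hfar : delta <= riem_dist D (induced_metric f) (line z e (t n)) p).
  { apply riem_dist_ge; [apply Hconn; [apply HD, Htn | exact Dp]|].
    intros l. apply Hpath. destruct Hout as [Ho|Ho].
    - left. specialize (Hclose (fst z) (fst e) (proj1 He1)). simpl in *.
      pose proof (Rabs_triang (fst z + T * fst e - (fst z + t n * fst e))
                    (fst z + t n * fst e - fst p)) as Tri.
      replace (fst z + T * fst e - (fst z + t n * fst e) + (fst z + t n * fst e - fst p))
        with (fst z + T * fst e - fst p) in Tri by ring. lra.
    - right. specialize (Hclose (snd z) (snd e) (proj2 He1)). simpl in *.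
      pose proof (Rabs_triang (snd z + T * snd e - (snd z + t n * snd e))
                    (snd z + t n * snd e - snd p)) as Tri.
      replace (snd z + T * snd e - (snd z + t n * snd e) + (snd z + t n * snd e - snd p))
        with (snd z + T * snd e - snd p) in Tri by ring. lra. }
  pose proof (Rle_abs (riem_dist D (induced_metric f) (line z e (t n)) p)). lra.
Qed.

Lemma Rbar_lt_between (a b : Rbar) : Rbar_lt a b -> exists x : R, Rbar_lt a x /\ Rbar_lt x b.
Proof.
  destruct a as [a| |], b as [b| |]; simpl; intros H; try contradiction.
  - exists ((a + b) / 2); lra.
  - exists (a + 1); split; [lra | exact I].
  - exists (b - 1); split; [exact I | lra].
  - exists 0; split; exact I.
Qed.

Lemma Rbar_lt_convex (a b : Rbar) (x y t : R) :
  Rbar_lt a x -> Rbar_lt a y -> Rbar_lt x b -> Rbar_lt y b ->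
  Rmin x y <= t <= Rmax x y -> Rbar_lt a t /\ Rbar_lt t b.
Proof.
  unfold Rmin, Rmax. intros H1 H2 H3 H4 Ht. split.
  - destruct a; simpl in *; auto. destruct Rle_dec; lra.
  - destruct b; simpl in *; auto. destruct Rle_dec; lra.
Qed.

Lemma rectangle_connected a b c d f p q :
  chebyshev (rectangle a b c d) f -> rectangle a b c d p -> rectangle a b c d q ->
  exists l, path_length (rectangle a b c d) (induced_metric f) p q l.
Proof.
  intros Hche ((P1 & P2) & (P3 & P4)) ((Q1 & Q2) & (Q3 & Q4)).
  set (ex := (1, 0) : R2). set (ey := (0, 1) : R2).
  assert (Hex : axis_direction ex) by (split; simpl; ring).
  assert (Hey : axis_direction ey) by (split; simpl; ring).
  assert (E1 : p = line (0, snd p) ex (fst p)).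
  { rewrite (surjective_pairing p) at 1. unfold line; simpl; f_equal; ring. }
  assert (E2 : line (0, snd p) ex (fst q) = line (fst q, 0) ey (snd p))
    by (unfold line; simpl; f_equal; ring).
  assert (E3 : q = line (fst q, 0) ey (snd q)).
  { rewrite (surjective_pairing q) at 1. unfold line; simpl; f_equal; ring. }
  exists (Rabs (fst q - fst p) + Rabs (snd q - snd p)).
  apply path_cat with (line (0, snd p) ex (fst q)).
  - rewrite E1 at 1. apply axis_path; [exact Hche | exact Hex |]. intros t Ht.
    destruct (Rbar_lt_convex a b _ _ t P1 Q1 P2 Q2 Ht).
    unfold line; split; simpl; split;
      rewrite ?Rmult_1_r, ?Rplus_0_l, ?Rmult_0_r, ?Rplus_0_r; assumption.
  - rewrite E2. rewrite E3 at 2. apply axis_path; [exact Hche | exact Hey |]. intros t Ht.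
    destruct (Rbar_lt_convex c d _ _ t P3 Q3 P4 Q4 Ht).
    unfold line; split; simpl; split;
      rewrite ?Rmult_1_r, ?Rplus_0_l, ?Rmult_0_r, ?Rplus_0_r; assumption.
Qed.

Lemma complete_rectangle_is_plane a b c d f :
  Rbar_lt a b -> Rbar_lt c d ->
  (forall z, rectangle a b c d z -> continuous (dx f) z /\ continuous (dy f) z) ->
  chebyshev (rectangle a b c d) f ->
  (forall p, rectangle a b c d p -> Rabs (dot (dx f p) (dy f p)) < 1) ->
  complete_metric (rectangle a b c d) (induced_metric f) ->
  forall p, rectangle a b c d p.
Proof.
  intros Hab Hcd Hf Hche Hang Hcomp.
  destruct (Rbar_lt_between a b Hab) as (x0 & A1 & A2).
  destruct (Rbar_lt_between c d Hcd) as (y0 & C1 & C2).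
  assert (K : forall e T, axis_direction e -> 0 < T ->
    (forall t, 0 <= t < T -> rectangle a b c d (line (x0, y0) e t)) ->
    rectangle a b c d (line (x0, y0) e T)).
  { intros e T He HT HD.
    apply (complete_axis_endpoint _ f (x0, y0) e T Hf Hche Hang); auto.
    intros p q Dp Dq. apply rectangle_connected; assumption. }
  assert (Ka : a = m_infty).
  { destruct a as [a| |]; [exfalso|contradiction|reflexivity].
    destruct (K (-1, 0) (x0 - a)) as ((H & _) & _); [split; simpl; ring | simpl in *; lra | |].
    - intros t Ht. unfold rectangle, line; simpl in *. rewrite Rmult_0_r, Rplus_0_r.
      repeat split; auto; [lra|]. destruct b; simpl in *; auto; lra.
    - simpl in H; lra. }
  assert (Kb : b = p_infty).
  { destruct b as [b| |]; [exfalso|reflexivity|contradiction].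
    destruct (K (1, 0) (b - x0)) as ((_ & H) & _); [split; simpl; ring | simpl in *; lra | |].
    - intros t Ht. unfold rectangle, line; simpl in *. rewrite Rmult_0_r, Rplus_0_r.
      repeat split; auto; [|lra]. destruct a; simpl in *; auto; lra.
    - simpl in H; lra. }
  assert (Kc : c = m_infty).
  { destruct c as [c| |]; [exfalso|contradiction|reflexivity].
    destruct (K (0, -1) (y0 - c)) as (_ & (H & _)); [split; simpl; ring | simpl in *; lra | |].
    - intros t Ht. unfold rectangle, line; simpl in *. rewrite Rmult_0_r, Rplus_0_r.
      repeat split; auto; [lra|]. destruct d; simpl in *; auto; lra.
    - simpl in H; lra. }
  assert (Kd : d = p_infty).
  { destruct d as [d| |]; [exfalso|reflexivity|contradiction].
    destruct (K (0, 1) (d - y0)) as (_ & (_ & H)); [split; simpl; ring | simpl in *; lra | |].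
    - intros t Ht. unfold rectangle, line; simpl in *. rewrite Rmult_0_r, Rplus_0_r.
      repeat split; auto; [|lra]. destruct c; simpl in *; auto; lra.
    - simpl in H; lra. }
  intros p. subst. repeat split; exact I.
Qed.

Theorem theorem5p3
  (a b c d : Rbar) (hab : Rbar_lt a b) (hcd : Rbar_lt c d)
  (D : R2 -> Prop) (hD : D = rectangle a b c d)
  (f N : R2 -> R3) (theta : R2 -> R)
  (hf : C1M D f)
  (hreg : regular D f)
  (hche : chebyshev D f)
  (hasy : asymptotic D f N)
  (htheta : forall p, D p ->
     0 < theta p < PI /\ is_angle (dx f p) (dy f p) (theta p))
  (hNdef : forall p, D p ->
     N p = scal (/ sin (theta p)) (cross (dx f p) (dy f p)))
  (hN : C1M D N)
  (hNxy : forall p, D p ->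
     dxy N p = scal (cos (theta p)) (N p) /\
     dyx N p = scal (cos (theta p)) (N p))
  (hfx : forall p, D p -> dx f p = cross (N p) (dx N p))
  (hfy : forall p, D p -> dy f p = opp (cross (N p) (dy N p))) :
  ~ complete_metric D (induced_metric f).
Proof.
  intros Hcomp. subst D.
  assert (HD : forall p, rectangle a b c d p).
  { apply (complete_rectangle_is_plane a b c d f hab hcd); [ | exact hche | | exact Hcomp].
    - intros z Dz. destruct (proj1 hf z Dz) as (_ & _ & H1 & H2). split; assumption.
    - intros p Dp. destruct (htheta p Dp) as (Ht & Ha). destruct (hche p Dp) as (H1 & H2).
      rewrite (chebyshev_cos _ _ _ H1 H2 Ha).
      assert (0 < sin (theta p)) by (apply sin_gt_0; apply Ht).
      pose proof (sin2_cos2 (theta p)) as E; unfold Rsqr in E.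
      apply Rabs_def1; nra. }
  apply (no_parallel_net_on_plane (dx f) (dy f) N theta).
  apply parallel_net_of_asymptotic_chebyshev; auto.
  - intros p. destruct (proj1 hf p (HD p)) as (_ & _ & H1 & H2). split; assumption.
  - intros p. destruct (proj1 hN p (HD p)) as (H1 & H2 & _).
    destruct (proj2 hN p (HD p)) as (H3 & H4 & _). repeat split; assumption.
Qed.
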